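(* Let $p\in\mathbb{N}=\{0,1,2,\dots\}$ and let $q$ be a non-critical offspring distribution ($\mu\neq 1$) that admits a moment of order $p$ (and satisfies the $L\log L$ condition $\mathbb{E}[Z_1\log Z_1]<+\infty$ if $p=1$). Assume furthermore that $q_0>0$ (which is true if $q$ is sub-critical). Then, for every $s\in[0,1)$, every $n\in\mathbb{N}$ and every $\Lambda_n\in\mathscr{F}_n$, $$\lim_{m\to+\infty}\frac{\mathbb{E}\left[H_p(Z_{m+n})s^{Z_{m+n}}\mathbf{1}_{\Lambda_n}\right]}{\mathbb{E}\left[H_p(Z_{m+n})s^{Z_{m+n}}\right]}=\mathbb{E}\left[\widetilde M_n^{(p)}\mathbf{1}_{\Lambda_n}\right],$$ where $$\widetilde M_n^{(p)}=\begin{cases}\kappa^{Z_n-1} & \text{if } p=0,\\[2pt] \dfrac{Z_n\kappa^{Z_n-1}}{f'(\kappa)^n} & \text{if } p\ge 1.\end{cases}$$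
   Context: $q=(q_n)_{n\in\mathbb{N}}$ is a probability distribution on the nonnegative integers with finite mean $\mu=\sum_n nq_n<+\infty$; it is sub-critical, critical, super-critical if $\mu<1$, $\mu=1$, $\mu>1$ respectively. $f$ is its generating function $f(s)=\sum_n q_ns^n$. $(Z_n)_{n\ge 0}$ is the Galton-Watson process with offspring distribution $q$ started from $Z_0=1$, and $(\mathscr{F}_n)_{n\ge 0}$ is its natural filtration. $\kappa$ is the extinction probability, i.e. the smallest nonnegative root of $f(s)=s$ (so $\kappa=1$ if $\mu<1$). The polynomials $H_p$ are $H_0(x)=1$ and $H_p(x)=\frac{1}{p!}\prod_{k=0}^{p-1}(x-k)$ for $p\ge 1$. Conventions: $0^0=1$ and $0\log 0=0$.
   Formalization: The cases where the quotient is 0/0 for all large m are excluded: s = 0 when p ≥ 1, q_0 = 1 when p = 1, and q_0 + q_1 = 1 when p ≥ 2. *)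

(* Defs.v *)
From HB Require Import structures.
From mathcomp Require Import all_boot all_order all_algebra.
From mathcomp Require Import all_classical all_reals all_analysis.
Import Order.TTheory GRing.Theory Num.Theory.
Import numFieldNormedType.Exports.

Set Implicit Arguments.
Unset Strict Implicit.
Unset Printing Implicit Defensive.

Local Open Scope classical_set_scope.
Local Open Scope ring_scope.

Definition prob_seq (R : realType) (q : R^nat) : Prop :=
  (forall k, 0 <= q k) /\ (\sum_(0 <= k <oo) (q k)%:E = 1)%E.

(* [0 ^+ 0 = 1], so the moment of order 0 is the total mass. *)
Definition moment (R : realType) (q : R^nat) (p : nat) : \bar R :=
  (\sum_(0 <= k <oo) (k%:R ^+ p * q k)%:E)%E.

Definition mean (R : realType) (q : R^nat) : \bar R := moment q 1.

Definition pgf (R : realType) (q : R^nat) (s : R) : R :=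
  limn (series (fun k => q k * s ^+ k)).

(* Derivative of [pgf q] as a function on [0, 1]: the series may diverge
   beyond 1, so at the end points this is the one-sided derivative. *)
Definition pgf_deriv (R : realType) (q : R^nat) (s : R) : R :=
  lim ((pgf q t - pgf q s) / (t - s) @[t --> within `[0, 1] (s^')]).

Definition mutually_independent d (T : measurableType d) (R : realType)
    (P : probability T R) d' (T' : measurableType d') (I : choiceType)
    (X : I -> {RV P >-> T'}) : Prop :=
  forall (J : seq I) (A : I -> set T'), uniq J ->
    (forall i, measurable (A i)) ->
    P (\bigcap_(i in [set` J]) (X i @^-1` A i)) =
    (\prod_(i <- J) P (X i @^-1` A i))%E.

Definition galton_watson d (T : measurableType d) (R : realType)
    (P : probability T R) (q : R^nat) (Z : nat -> T -> nat) : Prop :=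
  exists xi : nat * nat -> {RV P >-> nat},
    [/\ mutually_independent xi,
        forall i k, P (xi i @^-1` [set k]) = (q k)%:E,
        forall w, Z 0 w = 1%N &
        forall n w, Z n.+1 w = (\sum_(i < Z n w) xi (n, nat_of_ord i) w)%N].

Definition natural_filtration (T : Type) (Z : nat -> T -> nat) (n : nat) :
    set (set T) :=
  <<s [set A | exists k (B : set nat), (k <= n)%N /\ A = Z k @^-1` B] >>.

Definition extinction_probability d (T : measurableType d) (R : realType)
    (P : probability T R) (Z : nat -> T -> nat) : R :=
  fine (P [set w | exists n, Z n w = 0%N]).

Definition Hpoly (R : realType) (p : nat) : {poly R} :=
  (p`!%:R)^-1 *: \prod_(k < p) ('X - (k%:R)%:P).

(* The exponent [Z n w - 1] is an integer, equal to -1 when [Z n w = 0]. *)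
Definition limit_martingale d (T : measurableType d) (R : realType)
    (P : probability T R) (q : R^nat) (Z : nat -> T -> nat) (p n : nat)
    (w : T) : R :=
  let kappa := extinction_probability P Z in
  if p is 0 then kappa ^ ((Z n w)%:Z - 1)
  else (Z n w)%:R * kappa ^ ((Z n w)%:Z - 1) / pgf_deriv q kappa ^+ n.

(* Main.v *)
Require Import Defs.
From HB Require Import structures.
From mathcomp Require Import all_boot all_order all_algebra.
From mathcomp Require Import all_classical all_reals all_analysis.
From mathcomp Require Import measurable_realfun ring lra zify.
Import Order.TTheory GRing.Theory Num.Theory.
Import numFieldNormedType.Exports.

Set Implicit Arguments.
Unset Strict Implicit.
Unset Printing Implicit Defensive.

Local Open Scope classical_set_scope.
Local Open Scope ring_scope.

(** Write [f = pgf q], [kappa] for the extinction probability and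
    [gamma = f' kappa].  The weight [H_p Z * s ^ Z] is [s ^ p] times the
    coefficient of order [p] in the polynomial [(s + X) ^ Z]: it is a Taylor
    coefficient of [x ^ Z] at [s].  Polynomials of this kind are used as jets,
    only their coefficients up to order [p] being relevant, and [f] acts on
    jets by composition ([jet_map]).  Let [A_m] be the [m]-th iterate of this
    action on [s + X]; its value [x_m] is the [m]-th iterate of [f] at [s].

    By the branching property ([level_law_jet]), for an event [L] in [F_n] with
    [nu i = P (L, Z_n = i)], the numerator is [s ^ p] times the sum over [i] of
    [nu i] times the coefficient of order [p] in [A_m ^ i], while the
    denominator is [s ^ p] times the coefficient [a_(m + n)] of order [p] in
    [A_(m + n)].  Everything reduces to the behaviour of [A_m] for large [m].

    The values [x_m] tend to [kappa] ([cvg_iter_pgf]): the difference quotients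
    of [f] are monotone, so [f] contracts towards 1 when the mean is less than
    1, and towards [kappa < 1] on [[kappa, t]] for every [t < 1] when it exceeds
    1, because the chord from [kappa] to 1 has slope exactly 1.  This settles
    [p = 0] by dominated convergence.

    For [p >= 1], expand [A_m ^ i] in the powers of the part of [A_m] without
    constant term.  The first power gives [i * x_m ^ (i - 1) * a_m]; the powers
    [k >= 2] only involve products of at least two coefficients of order less
    than [p].  Applied to [f] itself, this shows by induction on the order that
    every coefficient of positive order has successive ratios tending to
    [gamma], with [0 < gamma < 1], since the remainder is quadratically small
    ([J_ratio]); hence [a_(m + n) / a_m] tends to [gamma ^ n].  In the numerator,
    the main term divided by [a_m] tends to the sum of
    [nu i * i * kappa ^ (i - 1)].  The remaining terms are largest when [L] is
    the whole space, where they equal the difference of the ratios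
    [a_(m + n) / a_m] of orders [p] and 1, so they vanish in the limit
    ([cvg_numerator_ratio]). *)

(** * Series of real numbers *)

Local Notation tsum u := (limn (series u)).

Section Series.
Context {R : realType}.
Implicit Types (u v b : nat -> R).

Lemma partial_le_tsum u n :
  (forall k, 0 <= u k) -> cvgn (series u) -> series u n <= tsum u.
Proof.
by move=> u0 cu; apply: nondecreasing_cvgn_le => //; exact: nondecreasing_series.
Qed.

Lemma tsum_ge0 u : (forall k, 0 <= u k) -> cvgn (series u) -> 0 <= tsum u.
Proof. by move=> u0 cu; have := partial_le_tsum 0 u0 cu; rewrite /series/= big_geq. Qed.

Lemma term_le_tsum u k :
  (forall k, 0 <= u k) -> cvgn (series u) -> u k <= tsum u.
Proof.
move=> u0 cu; apply: le_trans (partial_le_tsum k.+1 u0 cu).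
by rewrite /series/= big_nat_recr//= lerDr sumr_ge0.
Qed.

Lemma summable_of_bound u M :
  (forall k, 0 <= u k) -> (forall n, series u n <= M) -> cvgn (series u).
Proof.
move=> u0 uM; apply: nondecreasing_is_cvgn; first exact: nondecreasing_series.
by exists M => _ [n _ <-].
Qed.

Lemma EFin_tsum u : cvgn (series u) ->
  (\sum_(0 <= k <oo) (u k)%:E)%E = (tsum u)%:E.
Proof.
move=> cu; rewrite -EFin_lim//; apply/congr_lim/funext => n /=.
by rewrite /series/= -sumEFin.
Qed.

Lemma tail_le u b N : (forall k, u k <= b k) ->
  cvgn (series u) -> cvgn (series b) ->
  tsum u - series u N <= tsum b - series b N.
Proof.
move=> ub cu cb.
have : series (b - u) N <= tsum (b - u).
  apply: partial_le_tsum => [k|]; first by rewrite subr_ge0.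
  exact: is_cvg_seriesB.
by rewrite lim_seriesB// seriesD seriesN !fctE; lra.
Qed.

(** Tannery's theorem: dominated convergence for series. *)
Lemma tannery {T} {F : set_system T} {FF : ProperFilter F}
    (u : T -> nat -> R) v b :
  cvgn (series b) -> (\forall t \near F, forall k, 0 <= u t k <= b k) ->
  (forall k, u t k @[t --> F] --> v k) ->
  tsum (u t) @[t --> F] --> tsum v.
Proof.
move=> cb ub uv.
have vb k : 0 <= v k <= b k.
  rewrite -(cvg_lim _ (uv k))//; apply/andP; split.
    apply: limr_ge; first exact: cvgP (uv k).
    by apply: filterS ub => t /(_ k)/andP[].
  apply: limr_le; first exact: cvgP (uv k).
  by apply: filterS ub => t /(_ k)/andP[].
have b0 k : 0 <= b k by have /andP[] := vb k; exact: le_trans.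
have cvb w : (forall k, 0 <= w k <= b k) -> cvgn (series w).
  by move=> wb; apply: series_le_cvg cb => // k; have /andP[] := wb k.
apply/cvgrPdist_lt => e e0.
have [N bN] : exists N, tsum b - series b N < e / 2.
  have /cvgrPdist_lt /(_ (e / 2)) [|N _ HN] := cb; first by rewrite divr_gt0.
  exists N; have /= := HN N (leqnn N); rewrite ger0_norm//.
  by rewrite subr_ge0 partial_le_tsum.
have sN : series (u t) N @[t --> F] --> series v N.
  by rewrite /series/=; apply: cvg_big => [|k _]; [exact: add_continuous|exact: uv].
have /cvgrPdist_lt /(_ (e / 2)) := sN; rewrite divr_gt0// => /(_ isT) near_s.
near=> t.
have ubt : forall k, 0 <= u t k <= b k by near: t.
have st : `|series v N - series (u t) N| < e / 2 by near: t.
have cut := cvb _ ubt; have cv := cvb _ vb.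
have h1 := @tail_le (u t) b N (fun k => proj2 (andP (ubt k))) cut cb.
have h2 := @tail_le v b N (fun k => proj2 (andP (vb k))) cv cb.
have h3 := partial_le_tsum N (fun k => proj1 (andP (ubt k))) cut.
have h4 := partial_le_tsum N (fun k => proj1 (andP (vb k))) cv.
move: st; rewrite !ltr_norml => /andP[? ?]; apply/andP; split; lra.
Unshelve. all: by end_near. Qed.

Lemma cvg_exprn {T} {F : set_system T} {FF : Filter F} (f : T -> R) (a : R) n :
  f y @[y --> F] --> a -> f y ^+ n @[y --> F] --> a ^+ n.
Proof.
move=> fa; elim: n => [|n IH]; first by under eq_fun do rewrite expr0; exact: cvg_cst.
by under eq_fun do rewrite exprS; rewrite exprS; exact: cvgM.
Qed.

Lemma iter_contraction u c m : 0 <= c ->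
  (forall k, (k < m)%N -> u k.+1 <= c * u k) -> u m <= c ^+ m * u 0%N.
Proof.
move=> c0; elim: m => [|m IH] uc; first by rewrite expr0 mul1r.
apply: le_trans (uc m (ltnSn m)) _; rewrite exprS -mulrA ler_wpM2l// IH// => k km.
by apply: uc; rewrite ltnW.
Qed.

Lemma contraction_cvg0 u c : 0 <= c < 1 -> (forall m, 0 <= u m) ->
  (\forall m \near \oo, u m.+1 <= c * u m) -> u @ \oo --> (0 : R).
Proof.
move=> /andP[c0 c1] u0 [N _ uc]; rewrite -(cvg_shiftn N).
apply: (squeeze_cvgr (f := fun=> 0) (h := geometric (u N) c)).
- near=> m; rewrite u0/= /geometric/= mulrC.
  apply: (@iter_contraction (fun m => u (m + N)%N)) => // k _.
  by rewrite addSn; apply: uc; rewrite /= leq_addl.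
- exact: cvg_cst.
- by apply: cvg_geometric; rewrite ger0_norm.
Unshelve. all: by end_near. Qed.

End Series.

(** * Jets with nonnegative coefficients *)

Section Jets.
Context {R : realFieldType}.
Implicit Types (A B : {poly R}).

Definition nnpoly A := forall r, 0 <= A`_r.

Lemma nnpolyM A B : nnpoly A -> nnpoly B -> nnpoly (A * B).
Proof. by move=> A0 B0 r; rewrite coefM sumr_ge0// => t _; rewrite mulr_ge0. Qed.

Lemma nnpolyX A i : nnpoly A -> nnpoly (A ^+ i).
Proof.
move=> A0; elim: i => [|i IH]; last by rewrite exprS; exact: nnpolyM.
by move=> r; rewrite expr0 coef1 ler0n.
Qed.

Lemma coef0X A i : (A ^+ i)`_0 = A`_0 ^+ i.
Proof. by rewrite -!horner_coef0 horner_exp. Qed.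

Lemma eq_coefX A B i j : (forall r, (r <= j)%N -> A`_r = B`_r) ->
  (A ^+ i)`_j = (B ^+ i)`_j.
Proof.
elim: i j => [|i IH] j AB; first by rewrite !expr0.
rewrite !exprS !coefM; apply: eq_bigr => -[t /= tj] _; rewrite AB//.
by congr (_ * _); apply: IH => r rj; apply: AB; lia.
Qed.

Lemma coefX_low A k r : A`_0 = 0 -> (r < k)%N -> (A ^+ k)`_r = 0.
Proof.
move=> A0; elim: k r => // k IH r rk; rewrite exprS coefM big1// => -[[|t] /= tr] _.
  by rewrite A0 mul0r.
by rewrite IH ?mulr0//; lia.
Qed.

(** Only the coefficients of order [1 .. p-1] enter the [p]-th coefficient of a
    power [k >= 2] of a jet without constant term, so that coefficient is at
    most the value at 1 of the power of the truncated jet. *)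
Lemma coefX_le_sum A p k : nnpoly A -> A`_0 = 0 -> (2 <= k)%N ->
  (A ^+ k)`_p <= (\sum_(1 <= r < p) A`_r) ^+ k.
Proof.
move=> A0 A00; case: k => [|[|k]]// _.
have [->|p0] := posnP p; first by rewrite coef0X A00 expr0n/= exprn_ge0// big_geq.
pose B := \poly_(r < p) A`_r.
have B0 : nnpoly B by move=> r; rewrite coef_poly; case: ifP.
have -> : (A ^+ k.+2)`_p = (B ^+ k.+2)`_p.
  rewrite !(exprS _ k.+1) !coefM; apply: eq_bigr => -[t /= tp] _.
  rewrite coef_poly; case: ltnP => tp'.
    case: t tp tp' => [|t] tp tp'; first by rewrite A00 !mul0r.
    congr (_ * _); apply: eq_coefX => r rp; rewrite coef_poly ifT//; lia.
  have -> : t = p by lia.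
  by rewrite subnn coef0X A00 expr0n/= mulr0 mul0r.
have -> : \sum_(1 <= r < p) A`_r = B.[1].
  rewrite horner_poly -(big_mkord xpredT (fun i => A`_i * 1 ^+ i)).
  rewrite (big_ltn p0) A00 mul0r add0r.
  by apply: eq_bigr => r _; rewrite expr1n mulr1.
rewrite -horner_exp; have B1 := nnpolyX k.+2 B0.
have [pB|pB] := ltnP p (size (B ^+ k.+2)); last first.
  rewrite nth_default// horner_coef sumr_ge0// => r _.
  by rewrite expr1n mulr1.
rewrite horner_coef (bigD1 (Ordinal pB))//= expr1n mulr1 lerDl sumr_ge0// => r _.
by rewrite expr1n mulr1.
Qed.

(** The binomial expansion around the value of the jet.  The part without
    constant term is nilpotent to order [p], so the number of terms does not
    grow with [i]. *)
Lemma coefX_expand A i p : (A ^+ i)`_p =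
  \sum_(k < p.+1) A`_0 ^+ (i - k) * ((A - (A`_0)%:P) ^+ k)`_p *+ 'C(i, k).
Proof.
set x := A`_0; set N := A - x%:P.
have N0 : N`_0 = 0 by rewrite coefB coefC/= subrr.
have -> : A = x%:P + N by rewrite addrC subrK.
clearbody N.
rewrite exprDn coef_sum.
pose G k := x ^+ (i - k) * (N ^+ k)`_p *+ 'C(i, k).
have -> : \sum_(k < i.+1) ((x%:P ^+ (i - k) * N ^+ k) *+ 'C(i, k))`_p =
  \sum_(k < i.+1) G k.
  by apply: eq_bigr => k _; rewrite /G coefMn -rmorphXn/= coefCM.
have G0 k : (i < k)%N || (p < k)%N -> G k = 0.
  rewrite /G => /orP[ik|pk]; first by rewrite bin_small// mulr0n.
  by rewrite coefX_low// mulr0 mul0rn.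
suff ext n : (minn i p <= n)%N -> \sum_(k < n.+1) G k = \sum_(k < (minn i p).+1) G k.
  by rewrite !ext// ?geq_minl ?geq_minr.
move=> /subnK <-; elim: (n - _)%N => [|m IH]//.
by rewrite addSn big_ord_recr/= IH G0 ?addr0//; lia.
Qed.

Lemma bin_le_exp i k : ('C(i, k) <= i ^ k)%N.
Proof.
apply: (@leq_trans (i ^_ k)); first by rewrite -bin_ffact leq_pmulr ?fact_gt0.
by elim: k => // k IH; rewrite ffactnSr expnSr leq_mul// leq_subr.
Qed.

Section JetBounds.
Variable A : {poly R}.
Hypotheses (A0 : nnpoly A) (A1 : A`_0 <= 1).

Let N := A - (A`_0)%:P.

Lemma nnpoly_nilpotent : nnpoly N.
Proof.
by move=> [|r]; rewrite /N coefB coefC/= ?subrr// subr0.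
Qed.

Let coefN r : (0 < r)%N -> N`_r = A`_r.
Proof. by case: r => // r _; rewrite /N coefB coefC/= subr0. Qed.

Let N00 : N`_0 = 0. Proof. by rewrite /N coefB coefC/= subrr. Qed.

Let term_le i k p : A`_0 ^+ (i - k) * (N ^+ k)`_p *+ 'C(i, k)
  <= i%:R ^+ k * (N ^+ k)`_p.
Proof.
rewrite -[_ *+ 'C(i, k)]mulr_natl -natrX.
have Nk : 0 <= (N ^+ k)`_p by apply: nnpolyX; exact: nnpoly_nilpotent.
apply: ler_pM => //; first by rewrite mulr_ge0// exprn_ge0.
  by rewrite ler_nat bin_le_exp.
by rewrite ler_piMl// exprn_ile1.
Qed.

(** A jet with value at most 1 has powers whose coefficients grow at most
    polynomially, which is why a moment of the same order suffices to sum them. *)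
Lemma coefX_le_poly p i : (A ^+ i)`_p <=
  (1 + i%:R ^+ p) * \sum_(k < p.+1) (N ^+ k)`_p.
Proof.
rewrite coefX_expand mulr_sumr; apply: ler_sum => -[k /= kp] _.
apply: le_trans (term_le i k p) _.
have Nk : 0 <= (N ^+ k)`_p by apply: nnpolyX; exact: nnpoly_nilpotent.
apply: ler_wpM2r => //; have [->|i0] := posnP i.
  by rewrite !expr0n; case: k {kp Nk} => [|k]; case: p => [|p] /=; lra.
by rewrite -!natrX -[leLHS]add0r lerD// ler_nat leq_pexp2l.
Qed.

(** The terms of the product in which a single factor contributes the whole
    order [p]. *)
Lemma coefX_ge p i : (0 < p)%N ->
  i%:R * A`_0 ^+ i.-1 * A`_p <= (A ^+ i)`_p.
Proof.
move=> p0; elim: i => [|i IH]; first by rewrite !mul0r nnpolyX.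
rewrite exprS coefM (bigD1 ord0)//= (bigD1 ord_max)/=; last first.
  by rewrite -val_eqE/= -lt0n.
rewrite subn0 subnn coef0X addrA -[leLHS]addr0; apply: lerD; last first.
  by rewrite sumr_ge0// => k _; rewrite mulr_ge0// nnpolyX.
rewrite -natr1 mulrDl mul1r mulrDl.
rewrite lerD//; last by rewrite mulrC.
case: i IH => [|i] /= IH; first by rewrite !mul0r mulr_ge0// nnpolyX.
by rewrite exprS; apply: le_trans (ler_wpM2l (A0 0%N) IH); rewrite !mulrA [_ * i.+1%:R]mulrC.
Qed.

(** Besides the terms of [coefX_ge] there are only products of two or more
    coefficients of orders between 1 and [p - 1]. *)
Lemma coefX_le p i : (0 < p)%N -> \sum_(1 <= r < p) A`_r <= 1 ->
  (A ^+ i)`_p <= i%:R * A`_0 ^+ i.-1 * A`_p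
    + i%:R ^+ p * (p%:R * (\sum_(1 <= r < p) A`_r) ^+ 2).
Proof.
move=> p0; set sg := \sum_(1 <= r < p) _ => sg1.
have sg0 : 0 <= sg by rewrite sumr_ge0.
have sgN : sg = \sum_(1 <= r < p) N`_r.
  by apply: eq_big_nat => r /andP[r1 _]; rewrite coefN.
have [->|i0] := posnP i.
  rewrite !mul0r add0r expr0 coef1 [(p == 0)%N]eqn0Ngt p0/= mulr_ge0// ?exprn_ge0//.
  by rewrite mulr_ge0// exprn_ge0.
rewrite coefX_expand -(big_mkord xpredT
  (fun k => A`_0 ^+ (i - k) * ((A - (A`_0)%:P) ^+ k)`_p *+ 'C(i, k))).
rewrite big_ltn// big_ltn; last by rewrite ltnS.
rewrite expr0 coef1 [(p == 0)%N]eqn0Ngt p0 mulr0 mul0rn add0r expr1 -/N coefN//.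
apply: lerD; first by rewrite bin1 subn1 -mulr_natl mulrA.
have -> : i%:R ^+ p * (p%:R * sg ^+ 2) = \sum_(1 <= k < p.+1) i%:R ^+ p * sg ^+ 2.
  by rewrite sumr_const_nat subSS subn0 mulrCA mulr_natl.
rewrite [leRHS]big_ltn ?ltnS// -[leLHS]add0r; apply: lerD.
  by rewrite mulr_ge0// exprn_ge0.
apply: ler_sum_nat => k /andP[k2 kp]; apply: le_trans (term_le i k p) _.
have Nk : 0 <= (N ^+ k)`_p by apply: nnpolyX; exact: nnpoly_nilpotent.
apply: ler_pM => //; first by rewrite -!natrX ler_nat leq_pexp2l.
apply: le_trans (coefX_le_sum _ _ _ k2) _ => //; first exact: nnpoly_nilpotent.
by rewrite -sgN; apply: ler_wiXn2l.
Qed.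

(** One factor contributes order 1, another one order [p], the others their
    value. *)
Lemma coefX_gt0 p i : 0 < A`_0 -> 0 < A`_1 -> 0 < A`_p -> (2 <= i)%N ->
  0 < (A ^+ i)`_p.+1.
Proof.
move=> a0 a1 ap; case: i => [|[|i]]// _.
have h2 : 0 < (A ^+ 2)`_p.+1.
  rewrite expr2 coefM (bigD1 (Ordinal (isT : 1 < p.+2)%N))//= subSS subn0.
  by rewrite ltr_pwDl ?mulr_gt0// sumr_ge0// => k _; rewrite mulr_ge0.
rewrite -addn2 exprD coefM (bigD1 ord0)//= subn0 coef0X.
rewrite ltr_pwDl ?mulr_gt0 ?exprn_gt0// sumr_ge0// => k _.
by rewrite mulr_ge0// nnpolyX.
Qed.

End JetBounds.
End Jets.

(** * Convolution powers and composition *)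

Section Composition.
Context {R : realType}.
Implicit Types (q nu : nat -> R) (A B : {poly R}).

(** The law at [j] of the sum of [i] independent variables of law [q]: only the
    values up to [j] enter, so a truncation to a polynomial suffices. *)
Definition convpow q i j : R := ((\poly_(k < j.+1) q k) ^+ i)`_j.

Lemma convpowE q i j N : (j < N)%N -> ((\poly_(k < N) q k) ^+ i)`_j = convpow q i j.
Proof. by move=> jN; apply: eq_coefX => r rj; rewrite !coef_poly !ifT//; lia. Qed.

Lemma convpow0 q j : convpow q 0 j = (j == 0)%N%:R.
Proof. by rewrite /convpow expr0 coef1. Qed.

Lemma convpowS q i j :
  convpow q i.+1 j = \sum_(a < j.+1) convpow q i a * q (j - a)%N.
Proof.
rewrite /convpow exprSr coefM; apply: eq_bigr => a _.
rewrite convpowE// coef_poly ifT//; lia.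
Qed.

Lemma nnpoly_poly q N : (forall k, 0 <= q k) -> nnpoly (\poly_(k < N) q k).
Proof. by move=> q0 r; rewrite coef_poly; case: ifP. Qed.

Lemma convpow_ge0 q i j : (forall k, 0 <= q k) -> 0 <= convpow q i j.
Proof. by move=> q0; apply: nnpolyX; exact: nnpoly_poly. Qed.

Lemma convpow_ge q i j N : (forall k, 0 <= q k) ->
  ((\poly_(k < N) q k) ^+ i)`_j <= convpow q i j.
Proof.
move=> q0; elim: i j => [|i IH] j; first by rewrite expr0 coef1 convpow0.
rewrite exprSr coefM convpowS; apply: ler_sum => a _.
apply: ler_pM => //; [by apply: nnpolyX; exact: nnpoly_poly|exact: nnpoly_poly|].
by rewrite coef_poly; case: ifP.
Qed.

Lemma cvg_coefX (G : nat -> {poly R}) B i r :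
  (forall t, (t <= r)%N -> (G n)`_t @[n --> \oo] --> B`_t) ->
  ((G n) ^+ i)`_r @[n --> \oo] --> (B ^+ i)`_r.
Proof.
elim: i r => [|i IH] r GB; first by under eq_fun do rewrite expr0; exact: cvg_cst.
under eq_fun do rewrite exprS coefM.
rewrite exprS coefM; apply: cvg_big => [|[t /= tr] _]; first exact: add_continuous.
apply: cvgM; first by apply: GB; lia.
by apply: IH => u ur; apply: GB; lia.
Qed.

(** Composition with a power series turns the convolution power of the
    coefficients into the power of the composite.  Truncating [q] to a
    polynomial makes this an identity on compositions of polynomials; the
    truncations are squeezed between partial sums of the series. *)
Lemma series_convpow q A B i r : (forall k, 0 <= q k) -> nnpoly A ->
  (forall t, (t <= r)%N -> series (fun j => q j * (A ^+ j)`_t) @ \oo --> B`_t) ->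
  series (fun j => convpow q i j * (A ^+ j)`_r) @ \oo --> (B ^+ i)`_r.
Proof.
move=> q0 A0 qB; pose f N := \poly_(k < N) q k.
pose u j := convpow q i j * (A ^+ j)`_r.
have u0 j : 0 <= u j by rewrite mulr_ge0 ?convpow_ge0//; exact: nnpolyX.
have compE (g : {poly R}) N t : (size g <= N)%N ->
    (g \Po A)`_t = \sum_(0 <= j < N) g`_j * (A ^+ j)`_t.
  move=> gN; rewrite coef_comp_poly -(big_mkord xpredT (fun j => g`_j * (A ^+ j)`_t)).
  rewrite [RHS](big_cat_nat (leq0n _) gN)/= [X in _ = _ + X]big_nat [X in _ = _ + X]big1 ?addr0//.
  by move=> j /andP[gj _]; rewrite nth_default ?mul0r.
pose U N := ((f N \Po A) ^+ i)`_r.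
have UB : U N @[N --> \oo] --> (B ^+ i)`_r.
  apply: cvg_coefX => t tr; apply: cvg_trans (qB t tr).
  apply: near_eq_cvg; near=> N.
  rewrite (compE _ N) ?size_poly// /series/=; apply: eq_big_nat => j /andP[_ jN].
  by rewrite coef_poly jN.
have UE N M : (size (f N ^+ i) <= M)%N ->
    U N = \sum_(0 <= j < M) (f N ^+ i)`_j * (A ^+ j)`_r.
  by move=> sM; rewrite /U -rmorphXn/= (compE _ M).
have Upartial N : series u N <= U N.
  rewrite (UE N (maxn N (size (f N ^+ i)))) ?leq_maxr//.
  rewrite (big_cat_nat (leq0n _) (leq_maxl N (size (f N ^+ i))))/=.
  rewrite -[leLHS]addr0; apply: lerD; last first.
    by rewrite sumr_ge0// => j _; rewrite mulr_ge0// nnpolyX//; exact: nnpoly_poly.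
  by apply: ler_sum_nat => j /andP[_ jN]; rewrite convpowE.
have cu : cvgn (series u).
  have /cvg_seq_bounded/bounded_fun_has_ubound[M HM] := cvgP _ UB.
  apply: (summable_of_bound (M := M)) => // n.
  by apply: le_trans (Upartial n) _; apply: HM; exists n.
suff -> : (B ^+ i)`_r = tsum u by [].
apply/eqP; rewrite eq_le; apply/andP; split.
  rewrite -(cvg_lim _ UB)//; apply: limr_le; first exact: cvgP UB.
  near=> N; rewrite (UE N _ (leqnn _)).
  apply: le_trans (partial_le_tsum (size (f N ^+ i)) u0 cu).
  apply: ler_sum => j _; apply: ler_wpM2r; first exact: nnpolyX.
  exact: convpow_ge.
rewrite -(cvg_lim _ UB)//; apply: ler_lim => //; first exact: cvgP UB.
by near=> N.
Unshelve. all: by end_near. Qed.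

(** One generation of a branching process acts on laws by mixing convolution
    powers, hence on generating functions by composition with that of [q]. *)
Lemma esum_transition q nu nu' A B r :
  (forall k, 0 <= q k) -> (forall k, 0 <= nu k) -> nnpoly A ->
  (forall t, (t <= r)%N -> series (fun j => q j * (A ^+ j)`_t) @ \oo --> B`_t) ->
  (forall j, ((nu' j)%:E = \sum_(0 <= i <oo) (nu i * convpow q i j)%:E)%E) ->
  (\sum_(0 <= j <oo) (nu' j * (A ^+ j)`_r)%:E
    = \sum_(0 <= i <oo) (nu i * (B ^+ i)`_r)%:E)%E.
Proof.
move=> q0 nu0 A0 qB nuE.
have AX0 j : 0 <= (A ^+ j)`_r by apply: nnpolyX.
transitivity (\sum_(0 <= j <oo) \sum_(0 <= i <oo)
    (nu i * (convpow q i j * (A ^+ j)`_r))%:E)%E.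
  apply: eq_eseriesr => j _; rewrite mulrC EFinM nuE -nneseriesZl; last first.
    by move=> i _; rewrite lee_fin mulr_ge0// convpow_ge0.
  by apply: eq_eseriesr => i _; rewrite -EFinM mulrCA [_ * convpow _ _ _]mulrC.
rewrite nneseries_interchange; last first.
  by move=> i j; rewrite lee_fin !mulr_ge0// convpow_ge0.
apply: eq_eseriesr => i _.
under eq_eseriesr do rewrite EFinM.
rewrite nneseriesZl; last by move=> j _; rewrite lee_fin mulr_ge0// convpow_ge0.
have cB := @series_convpow q A B i r q0 A0 qB.
by rewrite EFin_tsum ?(cvgP _ cB)// (cvg_lim _ cB).
Qed.

End Composition.

(** * The generating function and its smallest fixed point *)

Section GeometricSum.
Context {R : realFieldType}.
Implicit Types t x : R.

(** The quotient [(t ^ k - x ^ k) / (t - x)], which makes sense for [t = x]. *)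
Definition geom k t x : R := \sum_(i < k) t ^+ (k.-1 - i) * x ^+ i.

Lemma geom_ge0 k t x : 0 <= t -> 0 <= x -> 0 <= geom k t x.
Proof. by move=> t0 x0; rewrite sumr_ge0// => i _; rewrite mulr_ge0// exprn_ge0. Qed.

Lemma ler_geom k t t' x : 0 <= t -> t <= t' -> 0 <= x -> geom k t x <= geom k t' x.
Proof.
move=> t0 tt' x0; apply: ler_sum => i _; apply: ler_wpM2r; first exact: exprn_ge0.
by apply: lerXn2r => //; rewrite nnegrE// (le_trans t0).
Qed.

Lemma geom_le k t x : 0 <= t <= 1 -> 0 <= x <= 1 -> geom k t x <= k%:R.
Proof.
move=> /andP[t0 t1] /andP[x0 x1].
have -> : k%:R = \sum_(i < k) 1 :> R by rewrite sumr_const card_ord.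
by apply: ler_sum => i _; rewrite mulr_ile1 ?exprn_ge0 ?exprn_ile1.
Qed.

Lemma geomxx k x : geom k x x = k%:R * x ^+ k.-1.
Proof.
rewrite mulr_natl -[X in _ = _ *+ X](card_ord k) -sumr_const; apply: eq_bigr => i _.
by rewrite -exprD subnK//; have := ltn_ord i; lia.
Qed.

Lemma ltr_geom k t x : 0 <= t -> t < 1 -> 0 <= x -> (2 <= k)%N ->
  geom k t x < geom k 1 x.
Proof.
move=> t0 t1 x0; case: k => [|[|k]]// _.
rewrite /geom [ltLHS]big_ord_recl [ltRHS]big_ord_recl /= !subn0 expr0 !mulr1.
apply: ltr_leD; last first.
  apply: ler_sum => i _; apply: ler_wpM2r; first exact: exprn_ge0.
  by rewrite expr1n exprn_ile1// ltW.
by rewrite expr1n exprn_ilt1.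
Qed.

End GeometricSum.

Section GeneratingFunction.
Context {R : realType}.
Variable q : nat -> R.
Hypothesis q_ge0 : forall k, 0 <= q k.
Hypothesis q_sum1 : series q @ \oo --> (1 : R).
Hypothesis q_mean : cvgn (series (fun k => q k * k%:R)).

Local Notation mu := (tsum (fun k => q k * k%:R)).

(** The difference quotient of [pgf q], extended to the diagonal. *)
Definition slope t x := tsum (fun k => q k * geom k t x).
(** The termwise derivative of [pgf q]; for a law of finite mean it
    converges up to the end point 1, where it is that mean. *)
Definition dpgf x := tsum (fun k => q k * (k%:R * x ^+ k.-1)).

Lemma summable_pgf x : 0 <= x <= 1 -> cvgn (series (fun k => q k * x ^+ k)).
Proof.
move=> /andP[x0 x1]; apply: series_le_cvg (cvgP _ q_sum1) => // k.
  by rewrite mulr_ge0// exprn_ge0.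
by rewrite ler_piMr// exprn_ile1.
Qed.

Lemma summable_slope t x : 0 <= t <= 1 -> 0 <= x <= 1 ->
  cvgn (series (fun k => q k * geom k t x)).
Proof.
move=> t01 x01; move: (t01) (x01) => /andP[t0 t1] /andP[x0 x1].
apply: series_le_cvg q_mean => k.
- by rewrite mulr_ge0// geom_ge0.
- by rewrite mulr_ge0.
- by rewrite ler_wpM2l// geom_le.
Qed.

Lemma slopexx x : slope x x = dpgf x.
Proof. by congr (limn (series _)); apply/funext => k; rewrite geomxx. Qed.

Lemma slope11 : slope 1 1 = mu.
Proof.
congr (limn (series _)); apply/funext => k.
by rewrite geomxx expr1n mulr1.
Qed.

Lemma pgfB t x : 0 <= t <= 1 -> 0 <= x <= 1 ->
  pgf q t - pgf q x = (t - x) * slope t x.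
Proof.
move=> t01 x01; rewrite /pgf -lim_seriesB; [|exact: summable_pgf..].
have <- : tsum ((t - x) *: (fun k => q k * geom k t x)) = (t - x) * slope t x.
  by rewrite lim_seriesZ//; exact: summable_slope.
congr (limn (series _)); apply/funext => k.
by rewrite !fctE /= -mulrBr subrXX mulrCA.
Qed.

Lemma ler_slope t t' x : 0 <= t -> t <= t' -> t' <= 1 -> 0 <= x <= 1 ->
  slope t x <= slope t' x.
Proof.
move=> t0 tt' t'1 /andP[x0 x1]; apply: lim_series_le; try apply: summable_slope; try lra.
by move=> k; rewrite ler_wpM2l// ler_geom.
Qed.

Lemma slope_ge0 t x : 0 <= t <= 1 -> 0 <= x <= 1 -> 0 <= slope t x.
Proof.
move=> t01 x01; apply: tsum_ge0; last exact: summable_slope.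
by move=> k; move: t01 x01 => /andP[? _] /andP[? _]; rewrite mulr_ge0// geom_ge0.
Qed.

Lemma slope_le t x : 0 <= t <= 1 -> 0 <= x <= 1 -> slope t x <= mu.
Proof.
move=> t01 x01; apply: lim_series_le => //; first exact: summable_slope.
by move=> k; rewrite ler_wpM2l// geom_le.
Qed.

(** Strict convexity, caused by a single coefficient of order at least 2. *)
Lemma ltr_slope k t x : 0 <= t -> t < 1 -> 0 <= x <= 1 ->
  (2 <= k)%N -> 0 < q k -> slope t x < slope 1 x.
Proof.
move=> t0 t1 x01 k2 qk; rewrite -subr_gt0.
have t01 : 0 <= t <= 1 by lra.
have l01 : 0 <= (1 : R) <= 1 by lra.
have ct := summable_slope t01 x01; have c1 := summable_slope l01 x01.
rewrite /slope -lim_seriesB//.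
have gg i : geom i t x <= geom i 1 x.
  by move: x01 => /andP[? _]; rewrite ler_geom// ltW.
apply: lt_le_trans (@term_le_tsum _ _ k _ (is_cvg_seriesB c1 ct)).
  rewrite !fctE -mulrBr mulr_gt0// subr_gt0 ltr_geom//.
  by move: x01 => /andP[].
by move=> i; rewrite !fctE -mulrBr mulr_ge0// subr_ge0.
Qed.

Lemma cvg_slope {T} {F : set_system T} {FF : ProperFilter F} (t x : T -> R) a b :
  (\forall y \near F, 0 <= t y <= 1) -> (\forall y \near F, 0 <= x y <= 1) ->
  t y @[y --> F] --> a -> x y @[y --> F] --> b ->
  slope (t y) (x y) @[y --> F] --> slope a b.
Proof.
move=> t01 x01 ta xb; apply: (tannery q_mean).
  near=> y.
  have t01y : 0 <= t y <= 1 by near: y.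
  have x01y : 0 <= x y <= 1 by near: y.
  move=> k; rewrite ler_wpM2l ?geom_le// mulr_ge0// geom_ge0//.
    by move: t01y => /andP[].
  by move: x01y => /andP[].
move=> k; apply: cvgM; first exact: cvg_cst.
rewrite /geom.
apply: cvg_big => [|i _]; first exact: add_continuous.
by apply: cvgM; exact: cvg_exprn.
Unshelve. all: by end_near. Qed.

Lemma cvg_pgf {T} {F : set_system T} {FF : ProperFilter F} (t : T -> R) a :
  (\forall y \near F, 0 <= t y <= 1) -> t y @[y --> F] --> a ->
  pgf q (t y) @[y --> F] --> pgf q a.
Proof.
move=> t01 ta; apply: (tannery (cvgP _ q_sum1)).
  near=> y.
  have /andP[t0 t1] : 0 <= t y <= 1 by near: y.
  by move=> k; rewrite mulr_ge0 ?exprn_ge0//= ler_piMr// exprn_ile1.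
move=> k; apply: cvgM; first exact: cvg_cst.
exact: cvg_exprn.
Unshelve. all: by end_near. Qed.

(** The difference quotients are continuous up to the diagonal, at the end point
    1 as well. *)
Lemma pgf_derivE x : 0 < x -> x <= 1 -> pgf_deriv q x = dpgf x.
Proof.
move=> x0 x1; have x01 : 0 <= x <= 1 by rewrite ltW.
(* [x] is a limit point of [[0, 1]] from the left, as [0 < x]. *)
have FF : ProperFilter (within `[0, 1] x^').
  apply: Build_ProperFilter_ex => B HB.
  have HL : \forall y \near x^'-, `[0, 1]%classic y -> B y.
    have HB' : \forall y \near x, y != x -> `[0, 1]%classic y -> B y := HB.
    rewrite /at_left near_withinE; apply: filterS HB' => y By yx.
    by apply: By; rewrite lt_eqF.
  near (x : R)^'- => y; exists y.
  have By : `[0, 1]%classic y -> B y by near: y.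
  apply: By; rewrite /= in_itv/=; apply/andP; split.
    by near: y; exact: nbhs_left_ge.
  by apply: le_trans x1; near: y; exact: nbhs_left_le.
have in01 : \forall y \near within `[0, 1] x^', 0 <= y <= 1.
  by apply: withinT => y /=; rewrite in_itv.
have neq : \forall y \near within `[0, 1] x^', y != x.
  apply: cvg_within; exact: withinT.
have cx : y @[y --> within `[0, 1] x^'] --> x.
  apply: cvg_trans (cvg_within _) _; exact: cvg_within.
rewrite /pgf_deriv -slopexx; apply: cvg_lim => //.
have := @cvg_slope _ _ FF id (fun=> x) x x in01 (nearW _ (fun=> x01)) cx (cvg_cst _).
move=> /(_ _ _) H; apply: cvg_trans H; apply: near_eq_cvg; near=> t.
have t01 : 0 <= t <= 1 by near: t.
have tx : t != x by near: t.
by rewrite /= pgfB// mulrAC divff ?mul1r// subr_eq0.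
Unshelve. all: by end_near. Qed.

Lemma pgf_ge0 x : 0 <= x <= 1 -> 0 <= pgf q x.
Proof.
move=> x01; apply: tsum_ge0; last exact: summable_pgf.
by move=> k; rewrite mulr_ge0// exprn_ge0//; move: x01 => /andP[].
Qed.

Lemma pgf1 : pgf q 1 = 1.
Proof.
rewrite /pgf -[RHS](cvg_lim _ q_sum1)//; congr (limn (series _)).
by apply/funext => k; rewrite expr1n mulr1.
Qed.

Lemma ler_pgf t x : 0 <= t -> t <= x -> x <= 1 -> pgf q t <= pgf q x.
Proof.
move=> t0 tx x1; apply: lim_series_le; try apply: summable_pgf; try lra.
by move=> k; rewrite ler_wpM2l// lerXn2r// nnegrE// (le_trans t0).
Qed.

Lemma pgf01 x : 0 <= x <= 1 -> 0 <= pgf q x <= 1.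
Proof.
move=> x01; rewrite pgf_ge0//= -pgf1; move: x01 => /andP[x0 x1]; exact: ler_pgf.
Qed.

Lemma q0_le_pgf x : 0 <= x <= 1 -> q 0%N <= pgf q x.
Proof.
move=> x01; have := @term_le_tsum _ _ 0%N _ (summable_pgf x01).
rewrite expr0 mulr1; apply=> k.
by rewrite mulr_ge0// exprn_ge0//; move: x01 => /andP[].
Qed.

Lemma iter_pgf01 m s : 0 <= s <= 1 -> 0 <= iter m (pgf q) s <= 1.
Proof. by move=> s01; elim: m => //= m IH; exact: pgf01. Qed.

Lemma ler_iter_pgf m s t : 0 <= s -> s <= t -> t <= 1 ->
  iter m (pgf q) s <= iter m (pgf q) t.
Proof.
move=> s0 st t1; elim: m => //= m IH; apply: ler_pgf => //.
  by have /andP[] : 0 <= iter m (pgf q) s <= 1 by apply: iter_pgf01; lra.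
by have /andP[] : 0 <= iter m (pgf q) t <= 1 by apply: iter_pgf01; lra.
Qed.

Let O01 : 0 <= (0 : R) <= 1. Proof. by rewrite lexx ler01. Qed.
Let I01 : 0 <= (1 : R) <= 1. Proof. by rewrite lexx ler01. Qed.

Lemma nondecreasing_iter_pgf : nondecreasing_seq (fun m => iter m (pgf q) 0).
Proof.
apply/nondecreasing_seqP => m; rewrite iterSr; apply: ler_iter_pgf => //.
  exact: pgf_ge0.
by have /andP[] := pgf01 O01.
Qed.

Lemma is_cvg_iter_pgf : cvgn (fun m => iter m (pgf q) 0).
Proof.
apply: nondecreasing_is_cvgn; first exact: nondecreasing_iter_pgf.
by exists 1 => _ [m _ <-]; have /andP[] := iter_pgf01 m O01.
Qed.

(** The smallest fixed point of [pgf q] in [[0, 1]], encoded as the limit of the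
    increasing iterates at 0 because these are the probabilities of extinction
    by a given generation. *)
Definition pgf_fix : R := limn (fun m => iter m (pgf q) 0).
Local Notation kappa := pgf_fix.

Lemma iter_pgf_le_fix m : iter m (pgf q) 0 <= kappa.
Proof.
by apply: nondecreasing_cvgn_le; [exact: nondecreasing_iter_pgf|exact: is_cvg_iter_pgf].
Qed.

Lemma pgf_fix_le x : 0 <= x <= 1 -> pgf q x <= x -> kappa <= x.
Proof.
move=> /andP[x0 x1] fx; apply: limr_le; first exact: is_cvg_iter_pgf.
near=> m; elim: (m) => //= k IH; apply: le_trans fx; apply: ler_pgf => //.
by have /andP[] := iter_pgf01 k O01.
Unshelve. all: by end_near. Qed.

Lemma pgf_fix01 : 0 <= kappa <= 1.
Proof.
by rewrite (iter_pgf_le_fix 0) pgf_fix_le// pgf1.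
Qed.

Lemma pgf_fixE : pgf q kappa = kappa.
Proof.
have c1 : pgf q (iter m (pgf q) 0) @[m --> \oo] --> pgf q kappa.
  apply: cvg_pgf is_cvg_iter_pgf; near=> m; exact: iter_pgf01.
have c2 : pgf q (iter m (pgf q) 0) @[m --> \oo] --> kappa.
  have := is_cvg_iter_pgf; rewrite -cvg_shiftS; exact.
by rewrite -(cvg_lim _ c1)// (cvg_lim _ c2).
Unshelve. all: by end_near. Qed.

Lemma q0_le_fix : q 0%N <= kappa.
Proof. by rewrite -pgf_fixE; apply: q0_le_pgf; exact: pgf_fix01. Qed.

Lemma exists_q_gt0 N : series q N < 1 -> exists2 k, (N <= k)%N & 0 < q k.
Proof.
move=> qN; apply: contrapT => noq.
have q_eq0 k : (N <= k)%N -> q k = 0.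
  move=> Nk; apply/eqP; rewrite eq_le q_ge0 andbT leNgt.
  by apply/negP => qk; apply: noq; exists k.
suff : (1 : R) <= series q N by rewrite leNgt qN.
rewrite -(cvg_lim _ q_sum1)//; apply: limr_le; first exact: cvgP q_sum1.
near=> n; have Nn : (N <= n)%N by near: n; exact: nbhs_infty_ge.
rewrite /series/= (big_cat_nat (leq0n _) Nn)/= [X in _ + X]big_nat.
by rewrite [X in _ + X]big1 ?addr0// => k /andP[Nk _]; exact: q_eq0.
Unshelve. all: by end_near. Qed.

Lemma dpgf_gt0 x : 0 < x -> x <= 1 -> q 0%N < 1 -> 0 < dpgf x.
Proof.
move=> x0 x1 q01; have [|k k1 qk] := @exists_q_gt0 1%N.
  by rewrite /series/= big_nat1.
have x01 : 0 <= x <= 1 by rewrite ltW.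
rewrite -slopexx; apply: lt_le_trans (@term_le_tsum _ _ k _ (summable_slope x01 x01)).
  by rewrite geomxx !mulr_gt0 ?exprn_gt0// ltr0n.
by move=> i; rewrite mulr_ge0// geom_ge0// ltW.
Qed.

Section Supercritical.
Hypothesis mu_gt1 : 1 < mu.

(** The slope at 1 is the mean, so just before 1 the graph of [pgf q] lies below
    the diagonal. *)
Lemma pgf_fix_lt1 : kappa < 1.
Proof.
have near01 : \forall t \near (1 : R)^'-, 0 <= t <= 1.
  near=> t; apply/andP; split; near: t; last exact: nbhs_left_le.
  exact: nbhs_left_ge.
have : slope t 1 @[t --> (1 : R)^'-] --> slope 1 1.
  apply: cvg_slope => //; first by near=> t; rewrite lexx ler01.
    by apply: cvg_at_left_filter; exact: cvg_id.
  exact: cvg_cst.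
rewrite slope11 => /cvgr_gt/(_ _ mu_gt1) slope_gt1.
near (1 : R)^'- => t.
have t01 : 0 <= t <= 1 by near: t.
have t1 : t < 1 by near: t; exact: nbhs_left_lt.
apply: le_lt_trans t1; apply: pgf_fix_le => //.
have s1 : 1 < slope t 1 by near: t.
have := pgfB t01 I01; rewrite pgf1 => E.
rewrite -subr_ge0; have -> : t - pgf q t = (1 - t) * (slope t 1 - 1).
  have -> : pgf q t = 1 + (t - 1) * slope t 1 by rewrite -E; ring.
  by ring.
by rewrite mulr_ge0// subr_ge0 ?ltW//; case/andP: t01.
Unshelve. all: by end_near. Qed.

(** The chord from [kappa] to 1 joins two fixed points and has slope 1; chords
    ending before 1 are less steep by strict convexity. *)
Lemma slope_fix x : 0 <= x -> x < 1 -> slope x kappa < 1.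
Proof.
move=> x0 x1; have [k k2 qk] : exists2 k, (2 <= k)%N & 0 < q k.
  apply: contrapT => noq; suff : mu <= 1 by rewrite leNgt mu_gt1.
  rewrite -[leRHS](cvg_lim _ q_sum1)//; apply: lim_series_le => //; first exact: cvgP q_sum1.
  case=> [|[|k]]; rewrite ?mulr0// ?mulr1//.
  have -> : q k.+2 = 0.
    apply/eqP; rewrite eq_le q_ge0 andbT leNgt.
    by apply/negP => qk; apply: noq; exists k.+2.
  by rewrite mul0r.
have k01 := pgf_fix01.
have <- : slope 1 kappa = 1; last exact: ltr_slope k2 qk.
have := pgfB I01 k01; rewrite pgf1 pgf_fixE => E.
have : 1 - kappa != 0 by rewrite gt_eqF// subr_gt0 pgf_fix_lt1.
by move=> nz; apply: (mulfI nz); rewrite mulr1 -E.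
Qed.

(** On [[kappa, x]] the map contracts towards [kappa] by [slope x kappa < 1]. *)
Lemma cvg_iter_pgf_above x : kappa <= x -> x < 1 ->
  iter m (pgf q) x @[m --> \oo] --> kappa.
Proof.
move=> kx x1; have k01 := pgf_fix01; have /andP[k0 _] := k01.
have x0 := le_trans k0 kx.
have slope01 : 0 <= slope x kappa by rewrite slope_ge0// x0 ltW.
have below m : kappa <= iter m (pgf q) x <= x.
  elim: m => /= [|m /andP[IH1 IH2]]; first by rewrite kx lexx.
  have y01 : 0 <= iter m (pgf q) x <= 1.
    by apply: iter_pgf01; rewrite x0 ltW.
  apply/andP; split; first by rewrite -pgf_fixE ler_pgf//; case/andP: y01.
  have := pgfB y01 k01; rewrite pgf_fixE => E.
  have s1 : slope (iter m (pgf q) x) kappa <= 1.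
    by apply: ltW; apply: slope_fix; [case/andP: y01|exact: le_lt_trans x1].
  by apply: le_trans IH2; rewrite -(lerD2r (- kappa)) E ler_piMr// subr_ge0.
have : iter m (pgf q) x - kappa @[m --> \oo] --> (0 : R).
  apply: (@contraction_cvg0 _ _ (slope x kappa)).
  - by rewrite slope01 slope_fix.
  - by move=> m; rewrite subr_ge0; case/andP: (below m).
  near=> m; have /andP[kb bx] := below m.
  have y01 : 0 <= iter m (pgf q) x <= 1.
    by apply: iter_pgf01; rewrite x0 ltW.
  have := pgfB y01 k01; rewrite pgf_fixE /= => ->.
  rewrite mulrC ler_wpM2r ?subr_ge0//; apply: ler_slope => //; last exact: ltW.
  by case/andP: y01.
move=> /(cvgD (cvg_cst kappa)) H; rewrite addr0 in H; move: H.
by apply: cvg_trans; apply: near_eq_cvg; near=> m; rewrite /= fctE addrC subrK.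
Unshelve. all: by end_near. Qed.

End Supercritical.

Section Subcritical.
Hypothesis mu_lt1 : mu < 1.

(** No chord is steeper than the mean, so the map contracts towards 1. *)
Lemma cvg_iter_pgf_sub x : 0 <= x <= 1 ->
  iter m (pgf q) x @[m --> \oo] --> (1 : R).
Proof.
move=> x01; have : 1 - iter m (pgf q) x @[m --> \oo] --> (0 : R).
  apply: (@contraction_cvg0 _ _ mu).
  - by rewrite mu_lt1 andbT tsum_ge0// => k; rewrite mulr_ge0.
  - by move=> m; rewrite subr_ge0; case/andP: (iter_pgf01 m x01).
  near=> m; have y01 := iter_pgf01 m x01.
  have := pgfB I01 y01; rewrite pgf1 /= => ->.
  rewrite mulrC ler_wpM2r// ?slope_le//.
  by rewrite subr_ge0; case/andP: y01.
move=> /(cvgB (cvg_cst (1 : R))) H; rewrite subr0 in H; move: H.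
by apply: cvg_trans; apply: near_eq_cvg; near=> m; rewrite /= !fctE subKr.
Unshelve. all: by end_near. Qed.

Lemma pgf_fix_eq1 : kappa = 1.
Proof. exact: cvg_lim (cvg_iter_pgf_sub O01). Qed.

End Subcritical.

Lemma cvg_iter_pgf x : mu != 1 -> 0 <= x -> x < 1 ->
  iter m (pgf q) x @[m --> \oo] --> kappa.
Proof.
rewrite neq_lt => /orP[mu1|mu1] x0 x1.
  by rewrite pgf_fix_eq1//; apply: cvg_iter_pgf_sub => //; rewrite x0 ltW.
have k1 := pgf_fix_lt1 mu1; have /andP[k0 _] := pgf_fix01.
pose y := Num.max x kappa.
have y1 : y < 1 by rewrite gt_max x1 k1.
apply: (squeeze_cvgr (f := fun m => iter m (pgf q) 0)
  (h := fun m => iter m (pgf q) y)).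
- near=> m; apply/andP; split; apply: ler_iter_pgf => //; try exact: ltW.
  by rewrite le_max lexx.
- exact: is_cvg_iter_pgf.
- by apply: cvg_iter_pgf_above => //; rewrite le_max lexx orbT.
Unshelve. all: by end_near. Qed.

Lemma dpgf_fix_lt1 : mu != 1 -> dpgf kappa < 1.
Proof.
rewrite neq_lt -slopexx => /orP[mu1|mu1].
  by rewrite pgf_fix_eq1// slope11.
by apply: slope_fix => //; [case/andP: pgf_fix01|exact: pgf_fix_lt1].
Qed.

End GeneratingFunction.

(** * The action of the generating function on jets *)

Section JetMap.
Context {R : realType}.
Variables (q : nat -> R) (p : nat).
Hypothesis q_ge0 : forall k, 0 <= q k.
Hypothesis q_sum1 : series q @ \oo --> (1 : R).
Hypothesis q_moment : cvgn (series (fun k => q k * k%:R ^+ p)).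
Implicit Types (A : {poly R}).

(** The action of the generating function on jets of order [p]. *)
Definition jet_map A : {poly R} :=
  \poly_(r < p.+1) tsum (fun j => q j * (A ^+ j)`_r).

(** The jets on which a generating function with enough moments acts; this class
    is stable under the action. *)
Definition subjet A := nnpoly A /\ A`_0 <= 1.

Lemma summable_moment r : (r <= p)%N ->
  cvgn (series (fun k => q k * k%:R ^+ r)).
Proof.
move=> rp; apply: (@series_le_cvg _ _ (q + (fun k => q k * k%:R ^+ p))).
- by move=> k; rewrite mulr_ge0// exprn_ge0.
- by move=> k; rewrite /= addr_ge0// mulr_ge0// exprn_ge0.
- move=> k; rewrite /= -[X in _ <= X + _]mulr1 -mulrDr ler_wpM2l//.
  have [->|k0] := posnP k.
    by rewrite !expr0n; case: r {rp} => [|r]; case: (p) => [|p'] /=; lra.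
  by rewrite -!natrX -[leLHS]add0r lerD// ler_nat leq_pexp2l.
- by apply: is_cvg_seriesD => //; exact: cvgP q_sum1.
Qed.

Lemma summable_jet A r : subjet A -> (r <= p)%N ->
  cvgn (series (fun j => q j * (A ^+ j)`_r)).
Proof.
move=> [A0 A1] rp; set C := \sum_(k < r.+1) ((A - (A`_0)%:P) ^+ k)`_r.
have C0 : 0 <= C by rewrite sumr_ge0// => k _; apply: nnpolyX; exact: nnpoly_nilpotent.
apply: (@series_le_cvg _ _ (C *: (q + (fun k => q k * k%:R ^+ r)))).
- by move=> k; rewrite mulr_ge0//; apply: nnpolyX.
- move=> k; rewrite /= mulr_ge0// addr_ge0// mulr_ge0// exprn_ge0//.
- move=> k; apply: le_trans (ler_wpM2l (q_ge0 k) (coefX_le_poly A0 A1 r k)) _.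
  rewrite -/C le_eqVlt; apply/orP; left; apply/eqP.
  by rewrite !fctE /GRing.scale/=; ring.
- apply: is_cvg_seriesZ; apply: is_cvg_seriesD; first exact: cvgP q_sum1.
  exact: summable_moment.
Qed.

Lemma coef_jet_map A r : (r <= p)%N ->
  (jet_map A)`_r = tsum (fun j => q j * (A ^+ j)`_r).
Proof. by move=> rp; rewrite coef_poly ltnS rp. Qed.

Lemma jet_map0 A : (jet_map A)`_0 = pgf q A`_0.
Proof.
rewrite coef_jet_map//; congr (limn (series _)); apply/funext => k.
by rewrite coef0X.
Qed.

Lemma subjet_map A : subjet A -> subjet (jet_map A).
Proof.
move=> sA; have [A0 A1] := sA; split; last first.
  have x01 : 0 <= A`_0 <= 1 by rewrite A0.
  by rewrite jet_map0; case/andP: (pgf01 q_ge0 q_sum1 x01).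
move=> r; rewrite coef_poly; case: ltnP => // rp.
apply: tsum_ge0; last exact: summable_jet.
by move=> k; rewrite mulr_ge0//; exact: nnpolyX.
Qed.

Lemma subjet_iter m A : subjet A -> subjet (iter m jet_map A).
Proof. by move=> sA; elim: m => //= m; exact: subjet_map. Qed.

Lemma iter_jet0 m A : (iter m jet_map A)`_0 = iter m (pgf q) A`_0.
Proof. by elim: m => //= m IH; rewrite jet_map0 IH. Qed.

Hypothesis p_gt0 : (0 < p)%N.

Let q_mean : cvgn (series (fun k => q k * k%:R)).
Proof.
have := summable_moment p_gt0.
by under [X in series X]eq_fun do rewrite expr1.
Qed.

Lemma dpgfM x a : 0 <= x <= 1 ->
  dpgf q x * a = tsum (fun k => q k * (k%:R * x ^+ k.-1 * a)).
Proof.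
move=> x01; have c := summable_slope q_ge0 q_mean x01 x01.
have E : (fun k => q k * geom k x x) = (fun k => q k * (k%:R * x ^+ k.-1)).
  by apply/funext => k; rewrite geomxx.
rewrite E in c; have <- : tsum (a *: (fun k => q k * (k%:R * x ^+ k.-1))) = dpgf q x * a.
  by rewrite lim_seriesZ// mulrC.
congr (limn (series _)); apply/funext => k; rewrite !fctE /GRing.scale/=; ring.
Qed.

Lemma summable_dpgf x a : 0 <= x <= 1 ->
  cvgn (series (fun k => q k * (k%:R * x ^+ k.-1 * a))).
Proof.
move=> x01; have c := summable_slope q_ge0 q_mean x01 x01.
have -> : (fun k => q k * (k%:R * x ^+ k.-1 * a)) = a *: (fun k => q k * geom k x x).
  by apply/funext => k; rewrite !fctE geomxx /GRing.scale/=; ring.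
exact: is_cvg_seriesZ.
Qed.

(** The derivative of [pgf q] multiplies every coefficient of positive order, up
    to the contribution of lower orders. *)
Lemma jet_map_ge A r : subjet A -> (0 < r <= p)%N ->
  dpgf q A`_0 * A`_r <= (jet_map A)`_r.
Proof.
move=> sA /andP[r0 rp]; have [A0 A1] := sA.
have x01 : 0 <= A`_0 <= 1 by rewrite A0.
rewrite coef_jet_map// dpgfM//; apply: lim_series_le.
- exact: summable_dpgf.
- exact: summable_jet.
- by move=> k; apply: ler_wpM2l => //; exact: coefX_ge.
Qed.

(** The contribution of lower orders is quadratic in the lower coefficients. *)
Lemma jet_map_le A r : subjet A -> (0 < r <= p)%N ->
  \sum_(1 <= t < r) A`_t <= 1 ->
  (jet_map A)`_r <= dpgf q A`_0 * A`_r
    + tsum (fun k => q k * k%:R ^+ r) * r%:R * (\sum_(1 <= t < r) A`_t) ^+ 2.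
Proof.
move=> sA /andP[r0 rp] sg1; have [A0 A1] := sA.
have x01 : 0 <= A`_0 <= 1 by rewrite A0.
set sg := \sum_(1 <= t < r) _ in sg1 *.
have cM := summable_moment rp.
rewrite coef_jet_map// dpgfM//.
have <- : tsum ((r%:R * sg ^+ 2) *: (fun k => q k * k%:R ^+ r))
    = tsum (fun k => q k * k%:R ^+ r) * r%:R * sg ^+ 2.
  by rewrite lim_seriesZ// /GRing.scale/=; ring.
rewrite -lim_seriesD; [|exact: summable_dpgf|exact: is_cvg_seriesZ].
apply: lim_series_le; first exact: summable_jet.
  by apply: is_cvg_seriesD; [exact: summable_dpgf|exact: is_cvg_seriesZ].
move=> k; rewrite !fctE; apply: le_trans (ler_wpM2l (q_ge0 k) (coefX_le A0 A1 k r0 sg1)) _.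
by rewrite -/sg le_eqVlt; apply/orP; left; apply/eqP; rewrite /GRing.scale/=; ring.
Qed.

Lemma jet_map_gt0 A r k : subjet A -> (r < p)%N -> (2 <= k)%N -> 0 < q k ->
  0 < A`_0 -> 0 < A`_1 -> 0 < A`_r -> 0 < (jet_map A)`_r.+1.
Proof.
move=> sA rp k2 qk a0 a1 ar; rewrite coef_jet_map//; have [A0 A1] := sA.
apply: lt_le_trans (@term_le_tsum _ _ k _ (summable_jet sA rp)).
  by rewrite mulr_gt0// coefX_gt0.
by move=> j; rewrite mulr_ge0//; exact: nnpolyX.
Qed.

End JetMap.

(** * Asymptotics of the iterated jets *)

(** There is room between [g ^ 2] and [g]: the square of a sequence decaying at a
    rate near [g] is negligible against a sequence decaying at such a rate. *)
Lemma rate_gap (R : realFieldType) (g : R) : 0 < g -> g < 1 ->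
  exists theta lambda,
    [/\ g < theta, theta < 1, lambda < g & theta ^+ 2 < lambda].
Proof.
move=> g0 g1; pose theta := 2 * g / (1 + g).
have theta2 : theta ^+ 2 < g.
  have g1_gt0 : 0 < 1 + g by lra.
  rewrite /theta expr_div_n ltr_pdivrMr ?exprn_gt0//.
  rewrite -subr_gt0; have -> : g * (1 + g) ^+ 2 - (2 * g) ^+ 2 = g * (1 - g) ^+ 2.
    by ring.
  by rewrite mulr_gt0// exprn_gt0// subr_gt0.
exists theta, ((theta ^+ 2 + g) / 2); split; [| |lra|lra].
- rewrite /theta ltr_pdivlMr; last by lra.
  have : 0 < g * (1 - g) by rewrite mulr_gt0// subr_gt0.
  by rewrite mulrBr mulr1 mulrDr mulr1; lra.
- by rewrite /theta ltr_pdivrMr; lra.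
Qed.

Section JetAsymptotics.
Context {R : realType}.
Variables (q : nat -> R) (p : nat) (A : {poly R}).
Hypothesis q_ge0 : forall k, 0 <= q k.
Hypothesis q_sum1 : series q @ \oo --> (1 : R).
Hypothesis q_moment : cvgn (series (fun k => q k * k%:R ^+ p)).
Hypothesis p_gt0 : (0 < p)%N.
Hypothesis q_mean : cvgn (series (fun k => q k * k%:R)).
Hypothesis mean_neq1 : tsum (fun k => q k * k%:R) != 1.
Hypothesis q0_gt0 : 0 < q 0%N.
Hypothesis q0_lt1 : q 0%N < 1.
Hypothesis q_branching : (2 <= p)%N -> exists2 k, (2 <= k)%N & 0 < q k.
Hypothesis sA : subjet A.
Hypothesis A0_gt0 : 0 < A`_0.
Hypothesis A0_lt1 : A`_0 < 1.
Hypothesis A1_gt0 : 0 < A`_1.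

Local Notation kappa := (pgf_fix q).
Local Notation gamma := (dpgf q kappa).
Local Notation J m := (iter m (jet_map q p) A).

Lemma subJ m : subjet (J m). Proof. exact: subjet_iter. Qed.

Lemma J0_01 m : 0 <= (J m)`_0 <= 1. Proof. by have [-> ->] := subJ m. Qed.

Lemma J0_gt0 m : 0 < (J m)`_0.
Proof.
case: m => // m; rewrite /= jet_map0; apply: lt_le_trans q0_gt0 _.
by apply: q0_le_pgf => //; exact: J0_01.
Qed.

Lemma kappa_gt0 : 0 < kappa.
Proof. exact: lt_le_trans q0_gt0 (q0_le_fix q_ge0 q_sum1). Qed.

Lemma gamma_gt0 : 0 < gamma.
Proof.
apply: dpgf_gt0 => //; first exact: kappa_gt0.
by case/andP: (pgf_fix01 q_ge0 q_sum1).
Qed.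

Lemma gamma_lt1 : gamma < 1. Proof. exact: dpgf_fix_lt1. Qed.

Lemma cvg_J0 : (J m)`_0 @[m --> \oo] --> kappa.
Proof.
under eq_fun do rewrite iter_jet0.
by apply: cvg_iter_pgf => //; rewrite ltW.
Qed.

Lemma cvg_dpgfJ0 : dpgf q (J m)`_0 @[m --> \oo] --> gamma.
Proof.
rewrite -slopexx; under eq_fun do rewrite -slopexx.
apply: cvg_slope => //; try exact: cvg_J0; near=> m; exact: J0_01.
Unshelve. all: by end_near. Qed.

Lemma dpgfJ0_gt0 m : 0 < dpgf q (J m)`_0.
Proof. by apply: dpgf_gt0 => //; [exact: J0_gt0|case/andP: (J0_01 m)]. Qed.

Lemma J1_gt0 m : 0 < (J m)`_1.
Proof.
elim: m => //= m IH.
apply: lt_le_trans (jet_map_ge q_ge0 q_sum1 q_moment p_gt0 (subJ m) _) => //.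
by rewrite mulr_gt0// dpgfJ0_gt0.
Qed.

(** A coefficient of order [r] appears after [r - 1] generations: each
    generation raises by one the largest order that is certainly present. *)
Lemma J_gt0 r m : (0 < r <= p)%N -> (r.-1 <= m)%N -> 0 < (J m)`_r.
Proof.
elim: r m => // r IH m /andP[_ rp] rm.
have [->|r0] := posnP r; first exact: J1_gt0.
case: m rm => [|m] rm; first by move: rm; lia.
have [k k2 qk] : exists2 k, (2 <= k)%N & 0 < q k by apply: q_branching; lia.
apply: (jet_map_gt0 q_ge0 q_sum1 q_moment (subJ m) rp k2 qk) => //.
- exact: J0_gt0.
- exact: J1_gt0.
- by apply: IH; lia.
Qed.

(** Coefficients of order at least 1 all decay at the same rate [gamma]: in the
    recursion for the [r]-th one, the remainder is quadratic in the lower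
    coefficients, hence of order [theta ^ (2 m)] for every [theta > gamma], and
    this is negligible as [gamma ^ 2 < gamma]. *)
Lemma J_ratio r : (0 < r <= p)%N ->
  (J m.+1)`_r / (J m)`_r @[m --> \oo] --> gamma.
Proof.
elim/ltn_ind: r => r IH rp; have /andP[r0 rp'] := rp.
have g0 := gamma_gt0; have g1 := gamma_lt1.
pose sg m := \sum_(1 <= t < r) (J m)`_t.
have sg_ge0 m : 0 <= sg m by rewrite sumr_ge0// => t _; case: (subJ m).
have [theta [lambda [gamma_lt_theta theta_lt1 lambda_lt theta2]]] :=
  rate_gap g0 g1.
have sg_le : \forall m \near \oo, sg m.+1 <= theta * sg m.
  have Jt (t : 'I_r) : \forall m \near \oo, (0 < t)%N ->
      (J m.+1)`_t <= theta * (J m)`_t.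
    have [->|t0] := posnP t; first by near=> m.
    have tp : (0 < t <= p)%N by rewrite t0/= (leq_trans _ rp')// ltnW.
    have /cvgr_lt/(_ _ gamma_lt_theta) := IH t (ltn_ord t) tp.
    move=> H; near=> m => _; have Jm : 0 < (J m)`_t.
      apply: J_gt0 => //; near: m; exact: nbhs_infty_ge.
    by rewrite -ler_pdivrMr// ltW//; near: m.
  have Jall : \forall m \near \oo, forall t : 'I_r, (0 < t)%N -> 
      (J m.+1)`_t <= theta * (J m)`_t by exact: filter_forall.
  apply: filterS Jall => m Jm.
  rewrite /sg mulr_sumr; apply: ler_sum_nat => t /andP[t1 tr].
  exact: (Jm (Ordinal tr)).
have sg_cvg0 : sg @ \oo --> (0 : R).
  apply: contraction_cvg0 sg_le => //; rewrite theta_lt1 andbT.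
  by rewrite ltW// (lt_trans g0).
pose b m := sg m ^+ 2 / (J m)`_r.
have b_cvg0 : b @ \oo --> (0 : R).
  have lambda_gt0 : 0 < lambda by rewrite (le_lt_trans _ theta2)// sqr_ge0.
  apply: (@contraction_cvg0 _ _ (theta ^+ 2 / lambda)).
  - by rewrite divr_ge0 ?sqr_ge0 ?ltW//= ltr_pdivrMr// mul1r.
  - by move=> m; rewrite divr_ge0 ?sqr_ge0//; case: (subJ m).
  have /cvgr_gt/(_ _ lambda_lt) := cvg_dpgfJ0; move=> H; near=> m.
  have Jm : 0 < (J m)`_r by apply: J_gt0 => //; near: m; exact: nbhs_infty_ge.
  have Jm1 : 0 < (J m.+1)`_r.
    by apply: J_gt0 => //; apply: leqW; near: m; exact: nbhs_infty_ge.
  have Jlambda : lambda * (J m)`_r <= (J m.+1)`_r.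
    apply: le_trans (jet_map_ge q_ge0 q_sum1 q_moment p_gt0 (subJ m) rp).
    by rewrite ler_pM2r// ltW//; near: m.
  have sm : sg m.+1 <= theta * sg m by near: m.
  rewrite /b ler_pdivrMr//.
  have -> : theta ^+ 2 / lambda * (sg m ^+ 2 / (J m)`_r) * (J m.+1)`_r
     = (theta * sg m) ^+ 2 * ((J m.+1)`_r / (lambda * (J m)`_r)).
    rewrite exprMn invfM; ring.
  rewrite -[leLHS]mulr1; apply: ler_pM => //; first exact: sqr_ge0.
    by rewrite lerXn2r// nnegrE// (le_trans _ sm).
  by rewrite ler_pdivlMr ?mulr_gt0// mul1r.
pose M := tsum (fun k => q k * k%:R ^+ r) * r%:R.
apply: (squeeze_cvgr (f := fun m => dpgf q (J m)`_0)
                     (h := fun m => dpgf q (J m)`_0 + M * b m)).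
- near=> m.
  have Jm : 0 < (J m)`_r by apply: J_gt0 => //; near: m; exact: nbhs_infty_ge.
  rewrite ler_pdivlMr// ler_pdivrMr// mulrDl.
  rewrite (jet_map_ge q_ge0 q_sum1 q_moment p_gt0 (subJ m) rp)/=.
  rewrite -[M * b m * _]mulrA /b divfK ?gt_eqF//.
  apply: (jet_map_le q_ge0 q_sum1 q_moment p_gt0 (subJ m) rp).
  near: m; apply: (cvgr_le _ sg_cvg0); exact: ltr01.
- exact: cvg_dpgfJ0.
- rewrite -[gamma in X in _ --> X]addr0; apply: cvgD; first exact: cvg_dpgfJ0.
  by rewrite -(mulr0 M); apply: cvgM => //; exact: cvg_cst.
Unshelve. all: by end_near. Qed.

Lemma J_ratio_iter r n : (0 < r <= p)%N ->
  (J (m + n)%N)`_r / (J m)`_r @[m --> \oo] --> gamma ^+ n.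
Proof.
move=> rp; elim: n => [|n IH].
  rewrite expr0; apply: cvg_near_cst; near=> m.
  rewrite addn0 divff// gt_eqF//; apply: J_gt0 => //; near: m; exact: nbhs_infty_ge.
have H : (J (m + n).+1)`_r / (J (m + n)%N)`_r @[m --> \oo] --> gamma.
  by have := J_ratio rp; rewrite -(cvg_shiftn n).
rewrite exprS; apply: cvg_trans (cvgM H IH); apply: near_eq_cvg; near=> m.
have Jm : 0 < (J (m + n)%N)`_r.
  by apply: J_gt0 => //; apply: leq_trans (leq_addr _ _); near: m; exact: nbhs_infty_ge.
by rewrite addnS [LHS]/= mulrA divfK ?gt_eqF.
Unshelve. all: by end_near. Qed.

Section Numerator.
Variables (nu w : nat -> R) (n : nat).
Hypothesis nu_ge0 : forall i, 0 <= nu i.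
Hypothesis nu_le : forall i, nu i <= w i.
Hypothesis w_mean : cvgn (series (fun i => w i * i%:R)).
Hypothesis w_jet : forall m r, (0 < r <= p)%N ->
  series (fun i => w i * ((J m) ^+ i)`_r) @ \oo --> (J (m + n)%N)`_r.

Let w_ge0 i : 0 <= w i. Proof. exact: le_trans (nu_le i). Qed.

Let d m i : R := i%:R * (J m)`_0 ^+ i.-1.

Let d_ge0 m i : 0 <= d m i.
Proof. by rewrite mulr_ge0// exprn_ge0// ltW// J0_gt0. Qed.

Let d_le m i : d m i <= i%:R.
Proof. by rewrite ler_piMr//; case/andP: (J0_01 m) => ? ?; rewrite exprn_ile1. Qed.

Let summable_d v m : (forall i, 0 <= v i <= w i) -> cvgn (series (fun i => v i * d m i)).
Proof.
move=> vw; have v0 i : 0 <= v i by case/andP: (vw i).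
apply: series_le_cvg w_mean => i; first by rewrite mulr_ge0.
  by rewrite mulr_ge0.
by rewrite ler_pM//; case/andP: (vw i).
Qed.

Let coefX1 m i : ((J m) ^+ i)`_1 = d m i * (J m)`_1.
Proof.
have [J0 J1] := subJ m; apply/eqP; rewrite eq_le coefX_ge// andbT.
have := @coefX_le _ _ J0 J1 1 i isT.
by rewrite big_geq// ler01 expr0n/= !mulr0 addr0; apply.
Qed.

Lemma summable_numerator m :
  cvgn (series (fun i => nu i * ((J m) ^+ i)`_p)).
Proof.
have pp : (0 < p <= p)%N by rewrite p_gt0 leqnn.
have J0 i : 0 <= ((J m) ^+ i)`_p by apply: nnpolyX; case: (subJ m).
apply: series_le_cvg (cvgP _ (@w_jet m _ pp)) => i; [by rewrite mulr_ge0..|].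
by rewrite ler_wpM2r.
Qed.

(** The powers beyond the first of the nilpotent part of the jet are negligible:
    their total contribution is largest for the full mass [w], and there it is
    the difference of two ratios with the same limit [gamma ^+ n]. *)
Lemma cvg_numerator_ratio :
  tsum (fun i => nu i * ((J m) ^+ i)`_p) / (J (m + n)%N)`_p @[m --> \oo] -->
  tsum (fun i => nu i * (i%:R * kappa ^+ i.-1)) / gamma ^+ n.
Proof.
have pp : (0 < p <= p)%N by rewrite p_gt0 leqnn.
have p1 : (0 < 1 <= p)%N by [].
pose N m := tsum (fun i => nu i * ((J m) ^+ i)`_p).
pose L m := tsum (fun i => nu i * d m i).
pose W m := tsum (fun i => w i * d m i).
have cL : L m @[m --> \oo] --> tsum (fun i => nu i * (i%:R * kappa ^+ i.-1)).
  apply: (tannery w_mean).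
    by near=> m => i; rewrite mulr_ge0//= ler_pM.
  move=> i; apply: cvgM; first exact: cvg_cst.
  apply: cvgM; first exact: cvg_cst.
  by apply: cvg_exprn; exact: cvg_J0.
have nuw i : 0 <= nu i <= w i by rewrite nu_ge0 nu_le.
have ww i : 0 <= w i <= w i by rewrite w_ge0 lexx.
have cZ v m a : (forall i, 0 <= v i <= w i) ->
    series (fun i => v i * d m i * a) @ \oo --> tsum (fun i => v i * d m i) * a.
  move=> vw; have -> : (fun i => v i * d m i * a) = a *: (fun i => v i * d m i).
    by apply/funext => i; rewrite !fctE /GRing.scale/= mulrC.
  rewrite seriesZ mulrC; apply: cvgM; [exact: cvg_cst | exact: summable_d].
(* At order 1 there is no remainder, and [W m] is exactly a ratio. *)
have WE m : W m * (J m)`_1 = (J (m + n)%N)`_1.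
  rewrite -(cvg_lim _ (@w_jet m _ p1))// -(cvg_lim _ (cZ w m (J m)`_1 ww))//.
  by congr (limn (series _)); apply/funext => i; rewrite coefX1 mulrA.
have NL m : L m * (J m)`_p <= N m.
  rewrite -(cvg_lim _ (cZ nu m (J m)`_p nuw))//; apply: lim_series_le.
  - exact: cvgP (cZ _ _ _ _).
  - exact: summable_numerator.
  - move=> i; rewrite -mulrA ler_wpM2l//; have [J0 J1] := subJ m.
    exact: coefX_ge.
have NU m : N m <= L m * (J m)`_p + ((J (m + n)%N)`_p - W m * (J m)`_p).
  have c1 := cvgP _ (cZ nu m (J m)`_p nuw).
  have c2 := cvgP _ (cZ w m (J m)`_p ww).
  have c3 := cvgP _ (@w_jet m _ pp).
  rewrite -(cvg_lim _ (cZ nu m (J m)`_p nuw))// -(cvg_lim _ (@w_jet m _ pp))//.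
  rewrite -(cvg_lim _ (cZ w m (J m)`_p ww))//.
  rewrite -lim_seriesB// -lim_seriesD//; last exact: is_cvg_seriesB.
  apply: lim_series_le; first exact: summable_numerator.
    by apply: is_cvg_seriesD => //; exact: is_cvg_seriesB.
  move=> i; rewrite !fctE; have [J0 J1] := subJ m.
  have h1 := coefX_ge J0 i p_gt0; have h2 := nu_le i.
  rewrite -subr_ge0.
  have -> : nu i * d m i * (J m)`_p
       + (w i * ((J m) ^+ i)`_p - w i * d m i * (J m)`_p)
       - nu i * ((J m) ^+ i)`_p
     = (w i - nu i) * (((J m) ^+ i)`_p - d m i * (J m)`_p) by ring.
  by rewrite mulr_ge0 ?subr_ge0.
have cN : N m / (J m)`_p @[m --> \oo] -->
    tsum (fun i => nu i * (i%:R * kappa ^+ i.-1)).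
  apply: (squeeze_cvgr (f := L) (h := fun m => L m +
    ((J (m + n)%N)`_p / (J m)`_p - (J (m + n)%N)`_1 / (J m)`_1))) => //.
    near=> m.
    have Jm : 0 < (J m)`_p by apply: J_gt0 => //; near: m; exact: nbhs_infty_ge.
    rewrite ler_pdivlMr// ler_pdivrMr// NL/= -WE mulfK ?gt_eqF ?J1_gt0//.
    by apply: le_trans (NU m) _; rewrite mulrDl mulrBl divfK ?gt_eqF.
  have diff0 : (J (m + n)%N)`_p / (J m)`_p - (J (m + n)%N)`_1 / (J m)`_1
      @[m --> \oo] --> gamma ^+ n - gamma ^+ n.
    by apply: cvgB; exact: J_ratio_iter.
  rewrite subrr in diff0.
  rewrite -[tsum _ in X in _ --> X]addr0; exact: cvgD.
have gn : gamma ^+ n != 0 by rewrite gt_eqF// exprn_gt0// gamma_gt0.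
have cR : ((J (m + n)%N)`_p / (J m)`_p)^-1 @[m --> \oo] --> (gamma ^+ n)^-1.
  by apply: cvgV => //; exact: J_ratio_iter.
apply: cvg_trans (cvgM cN cR); apply: near_eq_cvg; near=> m.
have Jm : 0 < (J m)`_p by apply: J_gt0 => //; near: m; exact: nbhs_infty_ge.
by rewrite [LHS]/= invf_div mulrA divfK// gt_eqF.
Unshelve. all: by end_near. Qed.

End Numerator.

End JetAsymptotics.

(** * Independent families of integer variables *)

Section Partition.
Context d (T : measurableType d) (R : realType) (P : probability T R).
Implicit Types (g : T -> nat) (D E : set T).

Lemma measurable_fiberwise g D :
  (forall c, measurable (D `&` g @^-1` [set c])) -> measurable D.
Proof.
move=> mD; have -> : D = \bigcup_c (D `&` g @^-1` [set c]).
  by apply/seteqP; split => [w Dw|w [c _ []]//]; exists (g w).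
exact: bigcupT_measurable.
Qed.

Lemma prob_fiberwise g D : (forall c, measurable (D `&` g @^-1` [set c])) ->
  P D = (\sum_(0 <= c <oo) P (D `&` g @^-1` [set c]))%E.
Proof.
move=> mD; have DE : D = \bigcup_c (D `&` g @^-1` [set c]).
  by apply/seteqP; split => [w Dw|w [c _ []]//]; exists (g w).
rewrite {1}DE measure_semi_bigcup//; last by rewrite -DE; exact: measurable_fiberwise mD.
by move=> c c' _ _ [w [[_ /= <-] [_ /= <-]]].
Qed.

End Partition.

Section IndependentFamily.
Context d (T : measurableType d) (R : realType) (P : probability T R).
Context (I : countType) (q : nat -> R) (xi : I -> {RV P >-> nat}).
Hypothesis q_ge0 : forall k, 0 <= q k.
Hypothesis xi_indep : mutually_independent xi.
Hypothesis xi_law : forall i k, P (xi i @^-1` [set k]) = (q k)%:E.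
Implicit Types (J : seq I) (D : set T).

Definition determined_by J D := forall w w',
  (forall i, i \in J -> xi i w = xi i w') -> D w -> D w'.

Definition atom J w0 : set T := \bigcap_(i in [set` J]) xi i @^-1` [set xi i w0].

Lemma measurable_xi i (B : set nat) : measurable (xi i @^-1` B).
Proof. by rewrite -[X in measurable X]setTI; exact: measurable_funP. Qed.

Lemma measurable_atom J w0 : measurable (atom J w0).
Proof. by apply: fin_bigcap_measurable => // i _; exact: measurable_xi. Qed.

Definition code J w : nat := pickle [seq xi i w | i <- J].

Lemma code_eq J w w' : code J w = code J w' <-> forall i, i \in J -> xi i w = xi i w'.
Proof.
split=> [/(pcan_inj pickleK) H i iJ|H]; last first.
  by congr pickle; apply/eq_in_map.
by move/eq_in_map : H; exact.
Qed.

(* Up to a countable partition, an event determined by [J] is an atom. *)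
Lemma determined_fiber J D c : determined_by J D ->
  D `&` code J @^-1` [set c] = set0 \/
  exists w0, D `&` code J @^-1` [set c] = atom J w0.
Proof.
move=> detD; have [->|/set0P[w0 [Dw0 /= w0c]]] := eqVneq (D `&` code J @^-1` [set c]) set0.
  by left.
right; exists w0; apply/seteqP; split => [w [Dw /= wc] i iJ|w aw].
  by have /code_eq/(_ i iJ) : code J w = code J w0 by rewrite wc.
have ww0 i : i \in J -> xi i w0 = xi i w by move=> iJ; rewrite (aw i iJ).
split; first exact: detD ww0 Dw0.
by rewrite /= -w0c; apply/code_eq => i iJ; rewrite ww0.
Qed.

Lemma measurable_determined J D : determined_by J D -> measurable D.
Proof.
move=> detD; apply: (measurable_fiberwise (g := code J)) => c.
by have [->|[w0 ->]] := determined_fiber c detD; [|exact: measurable_atom].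
Qed.

Lemma determined_fiberwise J D c : determined_by J D ->
  determined_by J (D `&` code J @^-1` [set c]).
Proof.
move=> detD w w' ww' [Dw /= <-]; split; first exact: detD Dw.
by apply/code_eq => i iJ; rewrite ww'.
Qed.

(** Mutual independence of the family indexed by [i0 :: J]. *)
Lemma prob_atom_cons J w0 i0 k : uniq J -> i0 \notin J ->
  P (atom J w0 `&` xi i0 @^-1` [set k]) = (P (atom J w0) * (q k)%:E)%E.
Proof.
move=> uJ i0J; pose B i := if i == i0 then [set k] else [set xi i w0].
have Bi0 : B i0 = [set k] by rewrite /B eqxx.
have -> : atom J w0 `&` xi i0 @^-1` [set k]
    = \bigcap_(i in [set` i0 :: J]) xi i @^-1` B i.
  apply/seteqP; split => [w [aw wk] i|w aw].
    rewrite /= inE /B; case: eqVneq => [->//|_ /=]; exact: aw.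
  split; last by have := aw i0; rewrite /= inE /B eqxx; exact.
  move=> i iJ; have := aw i; rewrite /= inE iJ orbT /B => /(_ isT).
  by case: eqVneq => // ii0; move: i0J; rewrite -ii0 iJ.
rewrite xi_indep//= ?i0J// big_cons muleC Bi0 xi_law; congr (_ * _)%E.
rewrite xi_indep//; apply: eq_big_seq => i iJ; rewrite /B ifF//.
by apply: contraNF i0J => /eqP <-.
Qed.

(** Independence of a further variable from any event that depends on finitely
    many others: such an event is a countable union of atoms. *)
Lemma prob_determined_cons J D i0 k : uniq J -> i0 \notin J ->
  determined_by J D ->
  P (D `&` xi i0 @^-1` [set k]) = (P D * (q k)%:E)%E.
Proof.
move=> uJ i0J detD.
have mD c := measurable_determined (@determined_fiberwise J D c detD).
rewrite (prob_fiberwise P mD) muleC -nneseriesZl//.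
rewrite (prob_fiberwise P (g := code J)); last first.
  by move=> c; rewrite setIAC; apply: measurableI => //; exact: measurable_xi.
apply: eq_eseriesr => c _; rewrite setIAC.
have [->|[w0 ->]] := determined_fiber c detD; first by rewrite set0I measure0 mule0.
by rewrite prob_atom_cons// muleC.
Qed.

End IndependentFamily.

Section OffspringSums.
Context d (T : measurableType d) (R : realType) (P : probability T R).
Context (q : nat -> R) (xi : nat * nat -> {RV P >-> nat}).
Hypothesis q_ge0 : forall k, 0 <= q k.
Hypothesis xi_indep : mutually_independent xi.
Hypothesis xi_law : forall i k, P (xi i @^-1` [set k]) = (q k)%:E.

Definition offspring n i (w : T) : nat := (\sum_(l < i) xi (n, l : nat) w)%N.

(** The offspring variables are added one by one, each being independent of the
    event and of the partial sum so far. *)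
Lemma prob_determined_offspring J (D : set T) n i j : uniq J ->
  (forall l, (n, l) \notin J) -> determined_by xi J D ->
  P (D `&` offspring n i @^-1` [set j]) = (P D * (convpow q i j)%:E)%E.
Proof.
move=> uJ nJ detD; elim: i j => [|i IH] j.
  rewrite convpow0; case: (eqVneq j 0%N) => [->|j0] /=.
    rewrite mule1; congr (P _); apply/seteqP; split => [w []//|w Dw]; split => //.
    by rewrite /= /offspring big_ord0.
  rewrite mule0 (_ : _ `&` _ = set0) ?measure0//; apply/seteqP; split => // w [_].
  by rewrite /= /offspring big_ord0 => j0'; move: j0; rewrite -j0' eqxx.
pose J' := J ++ [seq (n, l) | l <- iota 0 i].
have uJ' : uniq J'.
  rewrite cat_uniq uJ/= map_inj_uniq ?iota_uniq ?andbT; last by move=> l l' [].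
  by apply/hasPn => _ /mapP[l _ ->].
have niJ' : (n, i) \notin J'.
  rewrite mem_cat negb_or nJ/=; apply/negP => /mapP[l]; rewrite mem_iota => li [E].
  by move: li; rewrite -E/= ltnn.
have detJ' a : determined_by xi J' (D `&` offspring n i @^-1` [set a]).
  move=> w w' ww' [Dw /= <-]; split.
    by apply: detD Dw => k kJ; apply: ww'; rewrite mem_cat kJ.
  apply: eq_bigr => l _; rewrite ww'// mem_cat; apply/orP; right.
  by apply/mapP; exists (l : nat) => //; rewrite mem_iota/=.
have splitE a : D `&` offspring n i.+1 @^-1` [set j] `&` offspring n i @^-1` [set a]
   = if (a <= j)%N then (D `&` offspring n i @^-1` [set a])
        `&` xi (n, i) @^-1` [set (j - a)%N] else set0.
  apply/seteqP; split => w.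
    move=> [[Dw /= Sj] Sa]; have : (a + xi (n, i) w = j)%N.
      by rewrite -Sj -Sa /offspring big_ord_recr.
    move=> E; rewrite ifT; last by rewrite -E leq_addr.
    by split => //=; rewrite -E addKn.
  case: ifP => // aj [[Dw /= Sa] xa]; split => //; split => //=.
  by rewrite /offspring big_ord_recr/= -/(offspring n i w) Sa xa subnKC.
rewrite (prob_fiberwise P (g := offspring n i)); last first.
  move=> a; rewrite splitE; case: ifP => // _; apply: measurableI.
    exact: measurable_determined (detJ' a).
  exact: measurable_xi.
rewrite (@nneseries_split _ _ 0 j.+1)// add0n [X in (_ + X)%E]eseries0 ?adde0; last first.
  by move=> a ja _; rewrite splitE leqNgt ja/= measure0.
rewrite convpowS -sumEFin ge0_sume_distrr; last first.
  by move=> a _; rewrite lee_fin mulr_ge0// convpow_ge0.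
rewrite big_mkord; apply: eq_bigr => -[a /= aj] _.
rewrite splitE -ltnS aj (@prob_determined_cons _ _ _ _ _ q _ _ _ J')// IH.
by rewrite EFinM muleA.
Qed.

End OffspringSums.

(** * The branching property *)

Section Branching.
Context d (T : measurableType d) (R : realType) (P : probability T R).
Context (q : nat -> R) (Z : nat -> T -> nat) (xi : nat * nat -> {RV P >-> nat}).
Hypothesis q_ge0 : forall k, 0 <= q k.
Hypothesis xi_indep : mutually_independent xi.
Hypothesis xi_law : forall i k, P (xi i @^-1` [set k]) = (q k)%:E.
Hypothesis Z0 : forall w, Z 0 w = 1%N.
Hypothesis ZS : forall n w, Z n.+1 w = (\sum_(i < Z n w) xi (n, nat_of_ord i) w)%N.

(* For discrete processes, membership in the natural filtration means depending
   only on the history. *)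
Definition adapted n (D : set T) := forall w w',
  (forall k, (k <= n)%N -> Z k w = Z k w') -> D w -> D w'.

Lemma adapted_filtration n D : natural_filtration Z n D -> adapted n D.
Proof.
move: D; apply: smallest_sub.
  split=> [|A aA|A aA] w w' ww' //.
    by move=> [_ nA]; split => // Aw'; apply: nA; apply: aA Aw' => k kn; rewrite ww'.
  by move=> [i _ Aiw]; exists i => //; apply: aA Aiw.
by move=> _ [k [B [kn ->]]] w w' ww' /=; rewrite ww'.
Qed.

Lemma adapted_le m n D : (m <= n)%N -> adapted m D -> adapted n D.
Proof. by move=> mn aD w w' ww'; apply: aD => k km; apply: ww'; exact: leq_trans mn. Qed.

Lemma adapted_level k n (B : set nat) : (k <= n)%N -> adapted n (Z k @^-1` B).
Proof. by move=> kn w w' ww' /=; rewrite ww'. Qed.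

Lemma adaptedI n D E : adapted n D -> adapted n E -> adapted n (D `&` E).
Proof. by move=> aD aE w w' ww' [Dw Ew]; split; [exact: aD Dw|exact: aE Ew]. Qed.

Definition history n w : nat := pickle [seq Z k w | k <- iota 0 n.+1].

Lemma history_eq n w w' : history n w = history n w' <->
  forall k, (k <= n)%N -> Z k w = Z k w'.
Proof.
split=> [/(pcan_inj pickleK)/eq_in_map H k kn|H]; last first.
  by congr pickle; apply/eq_in_map => k; rewrite mem_iota add0n ltnS => /H.
by apply: H; rewrite mem_iota.
Qed.

(** Indices of the variables that determine the first [n] generations at [w]. *)
Definition ancestors n w : seq (nat * nat) :=
  [seq (k, l) | k <- iota 0 n, l <- iota 0 (Z k w)].

Lemma mem_ancestors n w k l :
  ((k, l) \in ancestors n w) = (k < n)%N && (l < Z k w)%N.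
Proof.
apply/allpairsPdep/idP => [[k' [l' [+ + [-> ->]]]]|/andP[kn lZ]].
  by rewrite !mem_iota/= !add0n => -> ->.
by exists k, l; rewrite !mem_iota.
Qed.

Lemma uniq_ancestors n w : uniq (ancestors n w).
Proof.
apply: allpairs_uniq_dep; [exact: iota_uniq|by move=> *; exact: iota_uniq|].
by move=> [k l] [k' l'] _ _ /= [-> ->].
Qed.

Lemma Z_determined n w w' :
  (forall i, i \in ancestors n w -> xi i w = xi i w') ->
  forall k, (k <= n)%N -> Z k w = Z k w'.
Proof.
move=> ww'; elim=> [|k IH] kn; first by rewrite !Z0.
rewrite !ZS -IH; last exact: ltnW.
by apply: eq_bigr => l _; apply: ww'; rewrite mem_ancestors kn /=.
Qed.

Lemma eq_ancestors n w w' : (forall k, (k <= n)%N -> Z k w = Z k w') ->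
  ancestors n w = ancestors n w'.
Proof.
move=> ww'; congr flatten; apply/eq_in_map => k; rewrite mem_iota add0n => /andP[_ kn].
by rewrite ww'// ltnW.
Qed.

(** Which offspring variables the first [n] generations depend on is random, but
    it is the same throughout a set of paths with a common history. *)
Lemma adapted_fiber n D c : adapted n D ->
  D `&` history n @^-1` [set c] = set0 \/
  exists w0, determined_by xi (ancestors n w0) (D `&` history n @^-1` [set c]).
Proof.
move=> aD; have [->|/set0P[w0 [Dw0 /= w0c]]] := eqVneq (D `&` history n @^-1` [set c]) set0.
  by left.
right; exists w0 => w w' ww' [Dw /= wc].
have /history_eq w0w : history n w0 = history n w by rewrite w0c wc.
have Zww' : forall k, (k <= n)%N -> Z k w = Z k w'.
  by apply: Z_determined => i; rewrite -(eq_ancestors w0w); exact: ww'.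
by split; [exact: aD Dw|rewrite /= -wc; apply/esym/history_eq].
Qed.

Lemma measurable_adapted n D : adapted n D -> measurable D.
Proof.
move=> aD; apply: (measurable_fiberwise (g := history n)) => c.
have [->|[w0 detD]] := adapted_fiber c aD; first exact: measurable0.
exact: measurable_determined detD.
Qed.

Lemma adapted_history n D c : adapted n D -> adapted n (D `&` history n @^-1` [set c]).
Proof.
move=> aD w w' ww' [Dw /= <-]; split; first exact: aD Dw.
by apply/esym/history_eq.
Qed.

(** Events of the first [n] generations are independent of the offspring numbers
    of generation [n], by summation over the countably many histories. *)
Lemma prob_adapted_offspring n D i j : adapted n D ->
  P (D `&` offspring xi n i @^-1` [set j]) = (P D * (convpow q i j)%:E)%E.
Proof.
move=> aD; have mD c := measurable_adapted (@adapted_history n D c aD).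
rewrite (prob_fiberwise P mD) muleC -nneseriesZl//.
have E c : D `&` offspring xi n i @^-1` [set j] `&` history n @^-1` [set c]
   = (D `&` history n @^-1` [set c]) `&` offspring xi n i @^-1` [set j].
  by rewrite setIAC.
have mO : measurable (offspring xi n i @^-1` [set j]).
  apply: (@measurable_determined _ _ _ P _ xi [seq (n, l) | l <- iota 0 i]).
  move=> w w' ww' /= <-; apply: eq_bigr => l _; rewrite ww'//.
  by apply/mapP; exists (l : nat) => //; rewrite mem_iota/=.
rewrite (prob_fiberwise P (g := history n)); last first.
  by move=> c; rewrite E; exact: measurableI.
apply: eq_eseriesr => c _; rewrite E.
have [->|[w0 detD]] := adapted_fiber c aD; first by rewrite set0I measure0 mule0.
rewrite (prob_determined_offspring q_ge0 xi_indep xi_law _ _ (uniq_ancestors n w0) _ detD) 1?muleC//.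
by move=> l; rewrite mem_ancestors ltnn.
Qed.

(** The law of [Z n] on the event [D], with total mass [P D].  The transition rule
    is linear in it, so it carries all that the future needs to know of [D]. *)
Definition level_law D n i : R := fine (P (D `&` Z n @^-1` [set i])).

Lemma level_law_ge0 D n i : 0 <= level_law D n i.
Proof. exact: fine_ge0. Qed.

Lemma measurable_level D n i : adapted n D -> measurable (D `&` Z n @^-1` [set i]).
Proof.
by move=> aD; apply: (@measurable_adapted n); apply: adaptedI => //; exact: adapted_level.
Qed.

Lemma EFin_level_law D n i : adapted n D ->
  (level_law D n i)%:E = P (D `&` Z n @^-1` [set i]).
Proof. by move=> aD; rewrite fineK// fin_num_measure//; exact: measurable_level. Qed.

Lemma level_law_transition n D j : adapted n D ->
  ((level_law D n.+1 j)%:E =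
    \sum_(0 <= i <oo) (level_law D n i * convpow q i j)%:E)%E.
Proof.
move=> aD; have aD1 := adapted_le (leqnSn n) aD.
rewrite EFin_level_law// (prob_fiberwise P (g := Z n)); last first.
  move=> i; apply: (@measurable_adapted n.+1); apply: adaptedI.
    by apply: adaptedI => //; exact: adapted_level.
  exact: adapted_level.
apply: eq_eseriesr => i _.
have aDi : adapted n (D `&` Z n @^-1` [set i]).
  by apply: adaptedI => //; exact: adapted_level.
rewrite EFinM EFin_level_law// -(@prob_adapted_offspring n _ i j aDi).
have ZE w : Z n w = i -> Z n.+1 w = offspring xi n i w.
  by move=> <-; rewrite ZS.
congr (P _); apply/seteqP; split => w [[Dw /= h1] h2].
  by split => //=; rewrite -ZE.
by split => //; split => //=; rewrite ZE.
Qed.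

Lemma expectation_level n D (c : nat -> R) : adapted n D -> (forall i, 0 <= c i) ->
  ('E_P[(fun w => c (Z n w) * \1_D w)%R] =
    \sum_(0 <= i <oo) (level_law D n i * c i)%:E)%E.
Proof.
move=> aD c0; rewrite unlock.
have mD := measurable_adapted aD.
have mZ (B : set nat) : measurable (Z n @^-1` B).
  by apply: (@measurable_adapted n); exact: adapted_level.
have mf : measurable_fun setT (fun w => (c (Z n w) * \1_D w)%:E).
  apply/measurable_EFinP; apply: measurable_funM; last exact: measurable_indic.
  by move=> _ B mB; rewrite setTI; exact: (mZ (c @^-1` B)).
have UZ : \bigcup_i Z n @^-1` [set i] = setT.
  by apply/seteqP; split => // w _; exists (Z n w).
rewrite -UZ ge0_integral_bigcup//; first last.
- by move=> i j _ _ [w [/= <- <-]].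
- by move=> w _; rewrite lee_fin mulr_ge0.
- by rewrite UZ.
apply: eq_eseriesr => i _.
rewrite (eq_integral (fun w => (c i)%:E * (\1_D w)%:E)%E); last first.
  by move=> w; rewrite inE /= => ->; rewrite EFinM.
rewrite ge0_integralZl//; last first.
- by rewrite lee_fin.
- by apply/measurable_EFinP; exact: measurable_indic.
by rewrite integral_indic// muleC EFinM EFin_level_law.
Qed.

Section BranchingJets.
Variable p : nat.
Hypothesis q_sum1 : series q @ \oo --> (1 : R).
Hypothesis q_moment : cvgn (series (fun k => q k * k%:R ^+ p)).

(** The branching property: running the process for [m] more generations amounts
    to substituting the [m]-th iterate of the generating function. *)
Lemma level_law_jet m n D A r : adapted n D -> subjet A -> (r <= p)%N ->
  (\sum_(0 <= j <oo) (level_law D (m + n) j * (A ^+ j)`_r)%:E =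
   \sum_(0 <= i <oo) (level_law D n i * (iter m (jet_map q p) A ^+ i)`_r)%:E)%E.
Proof.
elim: m A => [//|m IH] A aD sA rp.
have sF := subjet_map q_ge0 q_sum1 q_moment sA.
rewrite iterSr -IH//; apply: (@esum_transition _ q) => //.
- exact: level_law_ge0.
- by case: sA.
- move=> t tr; have tp := leq_trans tr rp.
  by rewrite coef_jet_map//; exact: (summable_jet q_ge0 q_sum1 q_moment sA tp).
- move=> j; rewrite addSn; apply: level_law_transition.
  by apply: adapted_le aD; exact: leq_addl.
Qed.

Lemma level_law0 i : level_law setT 0 i = (i == 1)%N%:R.
Proof.
rewrite /level_law setTI; case: (eqVneq i 1%N) => [->|i1] /=.
  rewrite (_ : _ @^-1` _ = setT) ?probability_setT//.
  by apply/seteqP; split => // w _ /=; rewrite Z0.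
rewrite (_ : _ @^-1` _ = set0) ?measure0//.
by apply/seteqP; split => // w /=; rewrite Z0 => i1'; move: i1; rewrite -i1' eqxx.
Qed.

(** The branching property from time 0, where the law is the Dirac mass at 1. *)
Lemma series_level_law_jet n A r : subjet A -> (r <= p)%N ->
  series (fun j => level_law setT n j * (A ^+ j)`_r) @ \oo -->
    (iter n (jet_map q p) A)`_r.
Proof.
move=> sA rp; set B := iter n _ _.
have B0 k : 0 <= (B ^+ k)`_r.
  by apply: nnpolyX; case: (subjet_iter q_ge0 q_sum1 q_moment n sA).
have E : (\sum_(0 <= j <oo) (level_law setT n j * (A ^+ j)`_r)%:E = (B`_r)%:E)%E.
  rewrite -[X in level_law _ X]addn0 level_law_jet//.
  rewrite (@nneseries_split _ _ 0 2); last first.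
    by move=> k _; rewrite lee_fin mulr_ge0// level_law_ge0.
  rewrite eseries0 ?adde0; last first.
    by move=> k k2 _; rewrite level_law0 gtn_eqF// mul0r.
  by rewrite !big_nat_recr//= big_geq// !level_law0/= mul0r mul1r expr1 !add0e.
have cu : cvgn (series (fun j => level_law setT n j * (A ^+ j)`_r)).
  apply: nnseries_is_cvg; last by rewrite E ltry.
  by move=> j; rewrite mulr_ge0 ?level_law_ge0//; apply: nnpolyX; case: sA.
by have := cu; have := E; rewrite EFin_tsum// => -[->].
Qed.

End BranchingJets.

Lemma level_law_le D n i : adapted n D -> level_law D n i <= level_law setT n i.
Proof.
move=> aD; rewrite -lee_fin !EFin_level_law//.
by apply: le_measure; rewrite ?inE; [exact: measurable_level..|exact: setSI].
Qed.

(** The state 0 is absorbing, so extinction is an increasing union. *)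
Lemma cvg_extinct :
  P (Z n @^-1` [set 0%N]) @[n --> \oo] --> P [set w | exists n, Z n w = 0%N].
Proof.
have -> : [set w | exists n, Z n w = 0%N] = \bigcup_n Z n @^-1` [set 0%N].
  by apply/seteqP; split => [w [n nw]|w [n _ nw]]; exists n.
have mZ n : measurable (Z n @^-1` [set 0%N]).
  by apply: (@measurable_adapted n); exact: adapted_level.
apply: nondecreasing_cvg_mu => //; first exact: bigcup_measurable.
apply/nondecreasing_seqP => n; apply/subsetPset => w /= Zw.
by rewrite ZS Zw big_ord0.
Qed.

End Branching.

(** * Moments weighted by a power, and the limit *)

Lemma cvg_EFin_seq (R : realType) (u : nat -> R) (l : R) :
  u m @[m --> \oo] --> l -> (u m)%:E @[m --> \oo] --> l%:E.
Proof. by move=> ul; apply: cvg_EFin => //; near=> m. Unshelve. all: by end_near. Qed.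

Section Hpolynomials.
Context {R : realType}.
Implicit Types (s : R).

Lemma horner_Hpoly p j : (Hpoly R p).[j%:R] = ('C(j, p))%:R.
Proof.
rewrite /Hpoly hornerZ.
have -> : (\prod_(k < p) ('X - (k%:R)%:P)).[j%:R] = (j ^_ p)%:R :> R.
  elim: p => [|p IH]; first by rewrite big_ord0 hornerC.
  rewrite big_ord_recr hornerM IH hornerXsubC ffactnSr natrM.
  have [pj|jp] := leqP p j; first by rewrite natrB.
  by rewrite ffact_small// !mul0r.
by rewrite -bin_ffact natrM mulrC mulfK// pnatr_eq0 -lt0n fact_gt0.
Qed.

Lemma coef_XDcX s p j : ((s%:P + 'X) ^+ j)`_p = s ^+ (j - p) * ('C(j, p))%:R.
Proof.
rewrite exprDn coef_sum.
under eq_bigr do rewrite coefMn -rmorphXn/= coefCM coefXn.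
have [pj|jp] := leqP p j.
  rewrite (bigD1 (Ordinal (pj : (p < j.+1)%N)))//= eqxx mulr1 big1 ?addr0 ?mulr_natr//.
  by move=> i; rewrite -val_eqE/= eq_sym => /negbTE ->; rewrite mulr0 mul0rn.
rewrite bin_small// mulr0 big1// => i _.
by rewrite gtn_eqF ?mulr0 ?mul0rn//; apply: leq_ltn_trans jp; rewrite -ltnS.
Qed.

(** The weights of the theorem are Taylor coefficients of powers; the identity
    holds for [j < p] too, both sides being 0. *)
Lemma Hpoly_jet s p j :
  (Hpoly R p).[j%:R] * s ^+ j = s ^+ p * ((s%:P + 'X) ^+ j)`_p.
Proof.
rewrite horner_Hpoly coef_XDcX; have [pj|jp] := leqP p j.
  by rewrite mulrA -exprD subnKC// mulrC.
by rewrite bin_small// mul0r !mulr0.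
Qed.

Lemma subjet_XDc s : 0 <= s <= 1 -> subjet (s%:P + 'X).
Proof.
move=> /andP[s0 s1]; split => [r|]; rewrite coefD coefC coefX ?addr0//.
by apply: addr_ge0; [case: ifP|rewrite ler0n].
Qed.

End Hpolynomials.

Section GaltonWatson.
Context d (T : measurableType d) (R : realType) (P : probability T R).
Context (q : nat -> R) (Z : nat -> T -> nat) (xi : nat * nat -> {RV P >-> nat}).
Hypothesis q_ge0 : forall k, 0 <= q k.
Hypothesis xi_indep : mutually_independent xi.
Hypothesis xi_law : forall i k, P (xi i @^-1` [set k]) = (q k)%:E.
Hypothesis Z0 : forall w, Z 0 w = 1%N.
Hypothesis ZS : forall n w, Z n.+1 w = (\sum_(i < Z n w) xi (n, nat_of_ord i) w)%N.
Hypothesis q_sum1 : series q @ \oo --> (1 : R).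
Hypothesis q_mean : cvgn (series (fun k => q k * k%:R)).

(** The jet 0 of order 0 has [j]-th power 1 if [j = 0] and 0 otherwise. *)
Lemma level_law_0 n : level_law P Z setT n 0%N = iter n (pgf q) 0.
Proof.
have q_moment0 : cvgn (series (fun k => q k * k%:R ^+ 0)).
  by under [X in series X]eq_fun do rewrite expr0 mulr1; exact: cvgP q_sum1.
have s0 : subjet (0 : {poly R}) by split => [r|]; rewrite coef0.
have H := @series_level_law_jet _ _ _ _ _ _ _ q_ge0 xi_indep xi_law Z0 ZS
  0 q_sum1 q_moment0 n _ 0 s0 isT.
rewrite iter_jet0 coef0 in H; rewrite -(cvg_lim _ H)//; apply/esym/cvg_lim => //.
apply: cvg_near_cst; near=> m.
have m0 : (0 < m)%N by near: m; exact: nbhs_infty_gt.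
rewrite /series/= big_ltn// expr0 coef1 mulr1 big_nat big1 ?addr0// => j /andP[j0 _].
by rewrite expr0n eqn0Ngt j0/= coef0 mulr0.
Unshelve. all: by end_near. Qed.

Lemma extinction_probabilityE : extinction_probability P Z = pgf_fix q.
Proof.
rewrite /extinction_probability.
have H1 := cvg_extinct Z0 ZS.
have H2 : P (Z n @^-1` [set 0%N]) @[n --> \oo] --> (pgf_fix q)%:E.
  have -> : (fun n => P (Z n @^-1` [set 0%N])) = EFin \o (fun n => iter n (pgf q) 0).
    apply/funext => n /=; rewrite -level_law_0.
    by rewrite (EFin_level_law Z0 ZS)// setTI.
  by apply: cvg_EFin; [near=> n|exact: is_cvg_iter_pgf].
by have -> := cvg_unique _ H1 H2.
Unshelve. all: by end_near. Qed.


Section Moments.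
Variables (p : nat) (s : R).
Hypothesis q_moment : cvgn (series (fun k => q k * k%:R ^+ p)).
Hypothesis s01 : 0 <= s <= 1.

Local Notation J m := (iter m (jet_map q p) (s%:P + 'X)).

Lemma expectation_Hpoly_event m n D : adapted Z n D ->
  ('E_P[(fun w => (Hpoly R p).[(Z (m + n)%N w)%:R] * s ^+ Z (m + n)%N w
                  * \1_D w)%R] =
   (s ^+ p)%:E * \sum_(0 <= i <oo) (level_law P Z D n i * (J m ^+ i)`_p)%:E)%E.
Proof.
move=> aD; have [s0 _] := andP s01.
have sA := subjet_XDc s01.
have c0 j : 0 <= (Hpoly R p).[j%:R] * s ^+ j.
  by rewrite Hpoly_jet mulr_ge0 ?exprn_ge0//; apply: nnpolyX; case: sA.
have aD' : adapted Z (m + n) D by apply: adapted_le aD; exact: leq_addl.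
rewrite (expectation_level Z0 ZS aD' c0).
under eq_eseriesr do rewrite Hpoly_jet mulrCA EFinM.
rewrite nneseriesZl; last first.
  move=> j _; rewrite lee_fin mulr_ge0 ?level_law_ge0//.
  by apply: nnpolyX; case: sA.
by rewrite (level_law_jet q_ge0 xi_indep xi_law Z0 ZS q_sum1 q_moment).
Qed.

Lemma expectation_Hpoly m :
  ('E_P[(fun w => (Hpoly R p).[(Z m w)%:R] * s ^+ Z m w)%R] =
   (s ^+ p * (J m)`_p)%:E)%E.
Proof.
have sA := subjet_XDc s01.
have -> : (fun w => (Hpoly R p).[(Z m w)%:R] * s ^+ Z m w)%R =
    (fun w => (Hpoly R p).[(Z (0 + m)%N w)%:R] * s ^+ Z (0 + m)%N w
       * \1_([set: T]) w)%R.
  by apply/funext => w; rewrite indicT mulr1 add0n.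
rewrite expectation_Hpoly_event//.
have c := series_level_law_jet (n := m) q_ge0 xi_indep xi_law Z0 ZS q_sum1 q_moment sA
  (leqnn p).
by rewrite EFin_tsum ?(cvgP _ c)// (cvg_lim _ c).
Qed.

End Moments.

(** The coefficient of order 1 in [(1 + X) ^ j] is [j]. *)
Lemma summable_level_mean n :
  cvgn (series (fun i => level_law P Z setT n i * i%:R)).
Proof.
have q_moment1 : cvgn (series (fun k => q k * k%:R ^+ 1)) by [].
have s1 : 0 <= (1 : R) <= 1 by rewrite ler01 lexx.
have c := series_level_law_jet (n := n) q_ge0 xi_indep xi_law Z0 ZS q_sum1 q_moment1
  (subjet_XDc s1) (leqnn 1).
have -> : (fun i => level_law P Z setT n i * i%:R) =
    (fun j => level_law P Z setT n j * ((1%:P + 'X) ^+ j)`_1).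
  by apply/funext => j; rewrite coef_XDcX expr1n mul1r bin1.
exact: cvgP c.
Qed.

Lemma summable_level_law n D : adapted Z n D ->
  cvgn (series (level_law P Z D n)).
Proof.
move=> aD; have q_moment0 : cvgn (series (fun k => q k * k%:R ^+ 0)).
  by under [X in series X]eq_fun do rewrite expr0 mulr1; exact: cvgP q_sum1.
have s1 : 0 <= (1 : R) <= 1 by rewrite ler01 lexx.
have c := series_level_law_jet (n := n) q_ge0 xi_indep xi_law Z0 ZS q_sum1 q_moment0
  (subjet_XDc s1) (leqnn 0).
apply: series_le_cvg (cvgP _ c) => j.
- exact: level_law_ge0.
- by rewrite mulr_ge0 ?level_law_ge0//; apply: nnpolyX; case: (subjet_XDc s1).
- by rewrite coef_XDcX expr1n mul1r bin0 mulr1; exact: level_law_le aD.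
Qed.

End GaltonWatson.

(* The last two hypotheses on [q] and the one on [s] exclude exactly the cases
   where the denominator vanishes for all large m, i.e. where the quotient is
   0 / 0: s = 0 with p >= 1, q_0 = 1 with p = 1, q_0 + q_1 = 1 with p >= 2. *)
Theorem theorem3p3 (d : measure_display) (T : measurableType d) (R : realType)
    (P : probability T R) (q : R^nat) (Z : nat -> T -> nat) (p : nat)
    (hq : prob_seq q)
    (hmean : (mean q < +oo)%E)
    (hZ : galton_watson P q Z)
    (hnoncrit : mean q <> 1%E)
    (hmoment : (moment q p < +oo)%E)
    (hLlogL : p = 1%N ->
       ('E_P[(fun w => (Z 1%N w)%:R * ln (Z 1%N w)%:R)%R] < +oo)%E)
    (hq0 : 0 < q 0%N)
    (hnd1 : p = 1%N -> q 0%N < 1)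
    (hnd2 : (2 <= p)%N -> q 0%N + q 1%N < 1)
    (s : R) (hs0 : 0 <= s) (hs1 : s < 1) (hs : (1 <= p)%N -> 0 < s)
    (n : nat) (Lambda : set T) (hLambda : natural_filtration Z n Lambda) :
  (fine 'E_P[(fun w => (Hpoly R p).[(Z (m + n)%N w)%:R] * s ^+ Z (m + n)%N w
                       * \1_Lambda w)%R]%E
   / fine 'E_P[(fun w => (Hpoly R p).[(Z (m + n)%N w)%:R]
                         * s ^+ Z (m + n)%N w)%R]%E)%:E
    @[m --> \oo]
  --> 'E_P[(fun w => limit_martingale P q Z p n w * \1_Lambda w)%R]%E.
Proof.
have [q_ge0 q_esum1] := hq.
have [xi [xi_indep xi_law Z0 ZS]] := hZ.
have q_summable : cvgn (series q) by apply: nnseries_is_cvg => //; rewrite q_esum1 ltry.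
have q_sum1 : series q @ \oo --> (1 : R).
  by move: (q_summable) q_esum1; rewrite EFin_tsum// => c [<-].
have summable_pow r : (moment q r < +oo)%E -> cvgn (series (fun k => q k * k%:R ^+ r)).
  move=> hr; under [X in series X]eq_fun do rewrite mulrC.
  by apply: nnseries_is_cvg hr => k; rewrite mulr_ge0// exprn_ge0.
have q_moment := summable_pow _ hmoment.
have q_mean : cvgn (series (fun k => q k * k%:R)) := summable_pow _ hmean.
have mean_neq1 : tsum (fun k => q k * k%:R) != 1.
  apply/eqP => mean1; apply: hnoncrit; rewrite -mean1 -EFin_tsum//.
  by apply: eq_eseriesr => k _; rewrite expr1 mulrC.
have aL := adapted_filtration hLambda.
have s01 : 0 <= s <= 1 by rewrite hs0 ltW.
have sA := subjet_XDc s01.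
have extE := extinction_probabilityE q_ge0 xi_indep xi_law Z0 ZS q_sum1.
have kappa_gt0 : 0 < pgf_fix q by apply: lt_le_trans hq0 (q0_le_fix q_ge0 q_sum1).
have kappa_le1 : pgf_fix q <= 1 by case/andP: (pgf_fix01 q_ge0 q_sum1).
pose nu := level_law P Z Lambda n.
pose w := level_law P Z setT n.
have nu_ge0 i : 0 <= nu i by exact: level_law_ge0.
have nu_le i : nu i <= w i by exact: level_law_le aL.
have w_mean : cvgn (series (fun i => w i * i%:R)).
  exact: (summable_level_mean q_ge0 xi_indep xi_law Z0 ZS q_sum1 q_mean).
have sp : s ^+ p != 0.
  case: (posnP p) => [->|p0]; first by rewrite expr0 oner_neq0.
  by rewrite expf_neq0// gt_eqF// hs.
have numE m : cvgn (series (fun i => nu i * (iter m (jet_map q p) (s%:P + 'X) ^+ i)`_p)) ->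
  fine 'E_P[(fun w => (Hpoly R p).[(Z (m + n)%N w)%:R] * s ^+ Z (m + n)%N w
                       * \1_Lambda w)%R]%E
   / fine 'E_P[(fun w => (Hpoly R p).[(Z (m + n)%N w)%:R]
                         * s ^+ Z (m + n)%N w)%R]%E =
   tsum (fun i => nu i * (iter m (jet_map q p) (s%:P + 'X) ^+ i)`_p)
     / (iter (m + n) (jet_map q p) (s%:P + 'X))`_p.
  move=> c.
  rewrite (expectation_Hpoly_event q_ge0 xi_indep xi_law Z0 ZS q_sum1 q_moment)//.
  rewrite (expectation_Hpoly q_ge0 xi_indep xi_law Z0 ZS q_sum1 q_moment)//.
  by rewrite EFin_tsum// -EFinM/= -mulf_div divff// mul1r.
have kappa_int k : pgf_fix q ^ (k%:Z - 1) = pgf_fix q ^+ k / pgf_fix q.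
  by rewrite expfzDr ?gt_eqF// exprN1.
have coef0A : (s%:P + 'X)`_0 = s by rewrite coefD coefC coefX addr0.
case: (posnP p) => [p0|p_gt0].
  have nu_summable : cvgn (series nu).
    exact: (summable_level_law q_ge0 xi_indep xi_law Z0 ZS q_sum1 aL).
  have x01 m := iter_pgf01 q_ge0 q_sum1 m s01.
  have k01 : 0 <= pgf_fix q <= 1 by rewrite ltW.
  have cx := cvg_iter_pgf q_ge0 q_sum1 q_mean mean_neq1 hs0 hs1.
  have summable_nu x : 0 <= x <= 1 -> cvgn (series (fun i => nu i * x ^+ i)).
    move=> /andP[x0 x1]; apply: series_le_cvg nu_summable => // i.
      by rewrite mulr_ge0// exprn_ge0.
    by rewrite ler_piMr// exprn_ile1.
  have coef0J m i : (iter m (jet_map q p) (s%:P + 'X) ^+ i)`_p = iter m (pgf q) s ^+ i.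
    by rewrite p0 coef0X iter_jet0 coef0A.
  have -> : 'E_P[(fun w => limit_martingale P q Z p n w * \1_Lambda w)%R]%E
      = (tsum (fun i => nu i * pgf_fix q ^+ i) / pgf_fix q)%:E.
    pose c i := pgf_fix q ^+ i / pgf_fix q.
    have -> : (fun w => limit_martingale P q Z p n w * \1_Lambda w)
        = (fun w => c (Z n w) * \1_Lambda w).
      by apply/funext => w'; rewrite /limit_martingale p0 extE kappa_int.
    have c0 i : 0 <= c i by rewrite divr_ge0 ?exprn_ge0// ltW.
    rewrite (expectation_level Z0 ZS aL c0) mulrC EFinM -EFin_tsum; last exact: summable_nu.
    rewrite -nneseriesZl; last first.
      by move=> i _; rewrite lee_fin mulr_ge0// exprn_ge0// ltW.
    by apply: eq_eseriesr => i _; rewrite -EFinM mulrA [in RHS]mulrC.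
  have cN : tsum (fun i => nu i * iter m (pgf q) s ^+ i) @[m --> \oo]
      --> tsum (fun i => nu i * pgf_fix q ^+ i).
    apply: (tannery nu_summable); last first.
      by move=> i; apply: cvgM; [exact: cvg_cst|exact: cvg_exprn].
    near=> m => i; have /andP[x0 x1] := x01 m.
    by rewrite mulr_ge0 ?exprn_ge0//= ler_piMr// exprn_ile1.
  have cD : (iter (m + n) (pgf q) s)^-1 @[m --> \oo] --> (pgf_fix q)^-1.
    by apply: cvgV; [rewrite gt_eqF|have := cx; rewrite -(cvg_shiftn n)].
  apply: cvg_EFin_seq; apply: cvg_trans (cvgM cN cD); apply: near_eq_cvg; near=> m.
  have E : (fun i => nu i * (iter m (jet_map q p) (s%:P + 'X) ^+ i)`_p)
      = (fun i => nu i * iter m (pgf q) s ^+ i).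
    by apply/funext => i; rewrite coef0J.
  rewrite [RHS]/= numE E; last exact: summable_nu.
  by rewrite p0 iter_jet0 coef0A.
have q0_lt1 : q 0%N < 1.
  have [p1|p1] := leqP 2 p; last by apply: hnd1; lia.
  by apply: le_lt_trans (hnd2 p1); rewrite lerDl.
have q_branching : (2 <= p)%N -> exists2 k, (2 <= k)%N & 0 < q k.
  move=> /hnd2 q01; apply: (exists_q_gt0 q_ge0 q_sum1).
  by rewrite /series/= !big_nat_recr//= big_geq// add0r.
have s_gt0 := hs p_gt0.
have coef1A : (s%:P + 'X)`_1 = 1 by rewrite coefD coefC coefX add0r.
have w_jet m r : (0 < r <= p)%N ->
    series (fun i => w i * (iter m (jet_map q p) (s%:P + 'X) ^+ i)`_r) @ \oo -->
    (iter (m + n) (jet_map q p) (s%:P + 'X))`_r.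
  move=> /andP[_ rp]; rewrite addnC iterD.
  apply: (series_level_law_jet q_ge0 xi_indep xi_law Z0 ZS q_sum1 q_moment) => //.
  exact: subjet_iter.
have A0_gt0 : 0 < (s%:P + 'X)`_0 by rewrite coef0A.
have A0_lt1 : (s%:P + 'X)`_0 < 1 by rewrite coef0A.
have A1_gt0 : 0 < (s%:P + 'X)`_1 by rewrite coef1A.
have -> : 'E_P[(fun w => limit_martingale P q Z p n w * \1_Lambda w)%R]%E
    = (tsum (fun i => nu i * (i%:R * pgf_fix q ^+ i.-1)) / dpgf q (pgf_fix q) ^+ n)%:E.
  have g0 : 0 < dpgf q (pgf_fix q) by apply: dpgf_gt0.
  pose c i := i%:R * pgf_fix q ^+ i.-1 / dpgf q (pgf_fix q) ^+ n.
  have -> : (fun w => limit_martingale P q Z p n w * \1_Lambda w)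
      = (fun w => c (Z n w) * \1_Lambda w).
    apply/funext => w'; rewrite /limit_martingale extE pgf_derivE//.
    case: (p) p_gt0 => // _ _; congr (_ / _ * _); rewrite kappa_int.
    by case: (Z n w') => [|k]; rewrite ?mul0r// exprSr mulfK// gt_eqF.
  have t0 i : 0 <= nu i * (i%:R * pgf_fix q ^+ i.-1).
    by rewrite !mulr_ge0// exprn_ge0// ltW.
  have c0 i : 0 <= c i by rewrite !mulr_ge0 ?invr_ge0 ?exprn_ge0// ltW.
  have c_summable : cvgn (series (fun i => nu i * (i%:R * pgf_fix q ^+ i.-1))).
    apply: series_le_cvg w_mean => // i.
      by rewrite mulr_ge0// (le_trans (nu_ge0 i)).
    rewrite ler_pM// ?mulr_ge0 ?exprn_ge0 ?(ltW kappa_gt0)//.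
    by rewrite ler_piMr// exprn_ile1// ltW.
  rewrite (expectation_level Z0 ZS aL c0) mulrC EFinM -EFin_tsum//.
  rewrite -nneseriesZl; last by move=> i _; rewrite lee_fin.
  by apply: eq_eseriesr => i _; rewrite -EFinM /c mulrA [in RHS]mulrC.
apply: cvg_EFin_seq; have H := cvg_numerator_ratio q_ge0 q_sum1 q_moment p_gt0 q_mean
  mean_neq1 hq0 q0_lt1 q_branching sA A0_gt0 A0_lt1 A1_gt0 nu_ge0 nu_le w_mean w_jet.
apply: cvg_trans H; apply: near_eq_cvg; near=> m; rewrite numE//.
exact: (summable_numerator q_ge0 q_sum1 q_moment p_gt0 sA nu_ge0 nu_le w_jet).
Unshelve. all: by end_near. Qed.
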